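(* Let $d\ge2$ be an even number and let $G$ be the pro-$3$ group generated by elements $x_1,\dots,x_d$ with the single relation $x_1^3[x_1,x_2]\cdots[x_{d-1},x_d]=1$. Then the canonical class $\gamma_G\in\mathrm{HH}^{3,-1}(H^\bullet(G,\mathbb{F}_3))$ of $G$ is non-trivial, and $G$ is not $A_3$-formal (with respect to the prime $3$).
   Context: **Presentation.** $[x,y]=x^{-1}y^{-1}xy$, the relator is $x_1^3[x_1,x_2][x_3,x_4]\cdots[x_{d-1},x_d]$, and $G$ is the quotient of the free pro-$3$ group on $x_1,\dots,x_d$ by the closed normal subgroup generated by the relator. **Cochains.** For a prime $p$, $\mathcal{C}^\bullet(G,\mathbb{F}_p)$ is the differential graded algebra of continuous inhomogeneous cochains $G^n\to\mathbb{F}_p$ (trivial coefficients) with differential $(\delta\varphi)(g_1,\dots,g_{n+1})=\varphi(g_2,\dots,g_{n+1})+\sum_{i=1}^n(-1)^i\varphi(g_1,\dots,g_ig_{i+1},\dots,g_{n+1})+(-1)^{n+1}\varphi(g_1,\dots,g_n)$ and cup product $(\varphi\cup\psi)(g_1,\dots,g_{i+j})=\varphi(g_1,\dots,g_i)\psi(g_{i+1},\dots,g_{i+j})$. Its cohomology is $H^\bullet(G,\mathbb{F}_p)$. **$A_3$-formality.** Let $\mathcal{A}$ be a differential graded algebra over a field $\mathbb{F}$ with differential $\delta$ that is connected ($\mathcal{A}^i=0$ for $i<0$, $\mathcal{A}^0=\mathbb{F}$), with cohomology algebra $H$. $\mathcal{A}$ is $A_3$-formal if there are graded $\mathbb{F}$-linear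 maps $f_i:H^{\otimes i}\to\mathcal{A}$ of degree $1-i$ for $i=1,2,3$ with $\delta f_1=0$ and $f_1$ inducing an isomorphism on cohomology, $\delta f_2(x,y)=f_1(xy)-f_1(x)f_1(y)$, and $\delta f_3(x,y,z)+(-1)^{|x|}f_1(x)f_2(y,z)-f_2(x,y)f_1(z)=f_2(xy,z)-f_2(x,yz)$ for all homogeneous $x,y,z$ (that is, $H$ with $m_1=0$, induced $m_2$ and $m_3=0$ is a minimal $A_3$-model of $\mathcal{A}$). $G$ is called $A_3$-formal with respect to $p$ if $\mathcal{C}^\bullet(G,\mathbb{F}_p)$ is. **Graded Hochschild cohomology.** For a non-negatively graded $\mathbb{F}$-algebra $A$ with $A^0=\mathbb{F}$ and a graded $A$-bimodule $M$, $\mathrm{HH}^{n,s}(A,M)$ is the $n$-th cohomology of the complex whose $n$-th term is the space of graded linear maps $A^{\otimes n}\to M$ raising degree by $s$, with differential $\partial f(a_1,\dots,a_{n+1})=(-1)^{s|a_1|}a_1f(a_2,\dots,a_{n+1})+\sum_{i=1}^n(-1)^if(a_1,\dots,a_ia_{i+1},\dots,a_{n+1})+(-1)^{n+1}f(a_1,\dots,a_n)a_{n+1}$. Write $\mathrm{HH}^{n,s}(A)=\mathrm{HH}^{n,s}(A,A)$. **Canonical class.** For connected $\mathcal{A}$ with cohomology $H$, choose a graded linear $f_1:H\to\ker\delta$ inducing the identity on $H$ and a graded linear $f_2:H\otimes H\to\mathcal{A}$ of degree $-1$ with $\delta f_2(x,y)=f_1(xy)-f_1(x)f_1(y)$. The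 elements $\Phi_3(x,y,z)=(-1)^{|x|}f_1(x)f_2(y,z)-f_2(x,y)f_1(z)-f_2(xy,z)+f_2(x,yz)$ are cocycles of $\mathcal{A}$. The induced map $m_3:H^{\otimes3}\to H$ of degree $-1$ is a Hochschild cocycle, and its class $\gamma_{\mathcal{A}}=[m_3]\in\mathrm{HH}^{3,-1}(H)$, which is independent of the choices, is the canonical class of $\mathcal{A}$. One sets $\gamma_G=\gamma_{\mathcal{C}^\bullet(G,\mathbb{F}_3)}$. *)

(* Defs.v *)
From HB Require Import structures.
From mathcomp Require Import all_boot all_order all_algebra.
From mathcomp Require Import generic_quotient ring_quotient ring.
From mathcomp Require Import all_classical topology.
Set Implicit Arguments.
Unset Strict Implicit.
Unset Printing Implicit Defensive.
Import GRing.Theory.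
Local Open Scope classical_set_scope.
Local Open Scope ring_scope.
Local Open Scope quotient_scope.

(* A non-negatively graded F-algebra A = A^0 + A^1 + ... with A^0 = F.  The
   carrier is the direct sum of the A^n, and hcomp n is the projection onto
   A^n, so that A^n = {x | hcomp n x = x}.  Non-triviality (1 != 0) is part of
   the library's algebra structure. *)
HB.mixin Record Algebra_isConnectedGraded (F : fieldType) A of GRing.Algebra F A := {
  hcomp : nat -> A -> A;
  hcomp_linear_subproof : forall n, linear (hcomp n);
  hcomp_hcomp : forall m n x, hcomp m (hcomp n x) = if m == n then hcomp n x else 0;
  hcomp_sum : forall x, exists N, x = \sum_(i < N) hcomp i x;
  hcomp_mul : forall m n x y,
    hcomp m x = x -> hcomp n y = y -> hcomp (m + n)%N (x * y) = x * y;
  hcomp1 : hcomp 0 1 = 1;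
  hcomp0_scalar : forall x, exists c : F, hcomp 0 x = c%:A;
}.

#[short(type="gradedAlgType")]
HB.structure Definition GradedAlgebra (F : fieldType) :=
  {A of GRing.Algebra F A & Algebra_isConnectedGraded F A}.

HB.instance Definition _ (F : fieldType) (A : gradedAlgType F) n :=
  GRing.isLinear.Build F A A *:%R (hcomp n) (hcomp_linear_subproof n).

(* x lies in A^k, where A^k = 0 for k < 0. *)
Definition homog (F : fieldType) (A : gradedAlgType F) (k : int) (x : A) : Prop :=
  match k with Posz n => hcomp n x = x | Negz _ => x = 0 end.

HB.mixin Record GradedAlgebra_isDGA (F : fieldType) A of GradedAlgebra F A := {
  dgad : A -> A;
  dgad_linear_subproof : linear dgad;
  dgad_hcomp : forall n x, hcomp n x = x -> hcomp n.+1 (dgad x) = dgad x;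
  dgadK : forall x, dgad (dgad x) = 0;
  dgadM : forall n x y, hcomp n x = x ->
    dgad (x * y) = dgad x * y + (-1) ^+ n *: (x * dgad y);
}.

#[short(type="dgaType")]
HB.structure Definition DGA (F : fieldType) :=
  {A of GradedAlgebra F A & GradedAlgebra_isDGA F A}.

HB.instance Definition _ (F : fieldType) (A : dgaType F) :=
  GRing.isLinear.Build F A A *:%R (@dgad F A) dgad_linear_subproof.

Section Cohomology.
Variables (F : fieldType) (A : dgaType F).
Implicit Types x y : A.

Lemma hcompS_dgad n x : hcomp n.+1 (dgad x) = dgad (hcomp n x).
Proof.
have [N xE] := hcomp_sum x.
have hd (i m : nat) : hcomp m (dgad (hcomp i x)) = if m == i.+1 then dgad (hcomp i x) else 0.
  have h : hcomp i.+1 (dgad (hcomp i x)) = dgad (hcomp i x).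
    by apply: dgad_hcomp; rewrite hcomp_hcomp eqxx.
  by rewrite -h hcomp_hcomp h.
have hE m : hcomp m (dgad x) = \sum_(i < N) if m == i.+1 then dgad (hcomp i x) else 0.
  by rewrite {1}xE !linear_sum /=; apply: eq_bigr => i _; rewrite hd.
rewrite hE [in RHS]xE !linear_sum /=; apply: eq_bigr => i _.
rewrite eqSS hcomp_hcomp; case: eqP => // _; exact/esym/linear0.
Qed.

Lemma hcomp0_dgad x : hcomp 0 (dgad x) = 0.
Proof.
have [N xE] := hcomp_sum x.
rewrite xE !linear_sum big1 //= => i _.
have h : hcomp i.+1 (dgad (hcomp i x)) = dgad (hcomp i x).
  by apply: dgad_hcomp; rewrite hcomp_hcomp eqxx.
by rewrite -h hcomp_hcomp.
Qed.

Lemma dgadMl x y : dgad x = 0 -> dgad y = 0 -> dgad (x * y) = 0.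
Proof.
move=> x0 y0; have [N xE] := hcomp_sum x.
have d0 i : dgad (hcomp i x) = 0 by rewrite -hcompS_dgad x0 linear0.
rewrite xE mulr_suml linear_sum big1 //= => i _.
by rewrite (@dgadM _ _ i) ?hcomp_hcomp ?eqxx // d0 mul0r y0 mulr0 scaler0 addr0.
Qed.

Lemma dgad1 : dgad (1 : A) = 0.
Proof.
have := @dgadM F A 0 1 1 hcomp1; rewrite mulr1 mul1r mulr1 scale1r.
by move/(congr1 (fun z => z - dgad 1)); rewrite subrr addrK.
Qed.

Definition cocycle : {pred A} := fun x => dgad x == 0.

Fact cocycle_subalg : subalg_closed cocycle.
Proof.
split=> [|a x y|x y]; rewrite !unfold_in; first by rewrite dgad1.
  by move=> /eqP x0 /eqP y0; rewrite linearP /= x0 y0 scaler0 addr0.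
by move=> /eqP x0 /eqP y0; rewrite dgadMl.
Qed.
HB.instance Definition _ := GRing.isSubalgClosed.Build F A cocycle cocycle_subalg.

(* The subalgebra Z(A) = ker dgad; cohomology A = Z(A) / im dgad. *)
Record cocycles := Cocycle { cocycle_val :> A; cocycleP : cocycle_val \in cocycle }.
HB.instance Definition _ := [isSub for cocycle_val].
HB.instance Definition _ := [Choice of cocycles by <:].
HB.instance Definition _ := [SubChoice_isSubAlgebra of cocycles by <:].

Definition coboundary : {pred cocycles} := fun z => `[< exists y : A, val z = dgad y >].

Fact coboundary_zmod : zmod_closed coboundary.
Proof.
split=> [|x y]; first by apply/asboolP; exists 0; rewrite linear0 raddf0.
move=> /asboolP[u uE] /asboolP[v vE]; apply/asboolP; exists (u - v).
by rewrite raddfB [RHS]linearB /= uE vE.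
Qed.
HB.instance Definition _ := GRing.isZmodClosed.Build cocycles coboundary coboundary_zmod.

Definition cohomology := {ideal_quot coboundary}.
HB.instance Definition _ := GRing.Zmodule.on cohomology.
HB.instance Definition _ := EqQuotient.on cohomology.
HB.instance Definition _ := ZmodQuotient.on cohomology.

Lemma cohomology_eq (x y : cocycles) :
  (\pi_cohomology x = \pi_cohomology y) <-> exists t : A, val x - val y = dgad t.
Proof.
have -> : (\pi_cohomology x = \pi_cohomology y) <-> (x - y \in coboundary).
  by rewrite Quotient.idealrBE; split=> /eqP.
by split=> /asboolP.
Qed.

Definition coh_scale (c : F) (h : cohomology) : cohomology := \pi_cohomology (c *: repr h).
Definition coh_one : cohomology := \pi_cohomology 1.
Definition coh_mul (h k : cohomology) : cohomology := \pi_cohomology (repr h * repr k).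

Lemma pi_add (x y : cocycles) :
  \pi_cohomology (x + y) = \pi_cohomology x + \pi_cohomology y.
Proof. exact: raddfD. Qed.

Lemma reprD (x : cocycles) : exists t, val (repr (\pi_cohomology x)) - val x = dgad t.
Proof.
by apply/cohomology_eq; rewrite reprK.
Qed.

Lemma pi_scale c (x : cocycles) : coh_scale c (\pi_cohomology x) = \pi_cohomology (c *: x).
Proof.
apply/cohomology_eq; have [t tE] := reprD x; exists (c *: t).
by rewrite [RHS]linearZ /= -tE [RHS]scalerBr.
Qed.

Lemma dgadMr_cocycle t (z : cocycles) : exists u, dgad t * val z = dgad u.
Proof.
have [N tE] := hcomp_sum t; exists (t * val z).
have z0 : dgad (val z) = 0 by apply/eqP/(valP z).
rewrite tE !mulr_suml !linear_sum /= mulr_suml; apply: eq_bigr => i _.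
rewrite (@dgadM _ _ i) ?hcomp_hcomp ?eqxx //.
by rewrite z0 mulr0 scaler0 addr0.
Qed.

Lemma dgadMl_cocycle (z : cocycles) t : exists u, val z * dgad t = dgad u.
Proof.
have [N zE] := hcomp_sum (val z).
have z0 : dgad (val z) = 0 by apply/eqP/(valP z).
have d0 i : dgad (hcomp i (val z)) = 0 by rewrite -hcompS_dgad z0 linear0.
exists (\sum_(i < N) (-1) ^+ i *: (hcomp i (val z) * t)).
rewrite {1}zE mulr_suml linear_sum /=; apply: eq_bigr => i _.
rewrite linearZ /= (@dgadM _ _ i) ?hcomp_hcomp ?eqxx // d0 mul0r add0r.
by rewrite scalerA -exprMn mulrNN mulr1 expr1n scale1r.
Qed.

Lemma pi_mul (x y : cocycles) : coh_mul (\pi_cohomology x) (\pi_cohomology y) = \pi_cohomology (x * y).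
Proof.
apply/cohomology_eq; have [t tE] := reprD x; have [s sE] := reprD y.
have [u uE] := dgadMl_cocycle x s.
have [v vE] := dgadMr_cocycle t (repr (\pi_cohomology y)).
exists (u + v); rewrite linearD /= -uE -vE -sE -tE.
by rewrite mulrBl mulrBr [RHS]addrC [RHS]addrA subrK.
Qed.

Fact coh_scaleA a b h : coh_scale a (coh_scale b h) = coh_scale (a * b) h.
Proof. by elim/quotW: h => h; rewrite (pi_scale b h) !pi_scale scalerA. Qed.
Fact coh_scale1 : left_id 1 coh_scale.
Proof. by elim/quotW => h; rewrite pi_scale scale1r. Qed.
Fact coh_scaleDr : right_distributive coh_scale +%R.
Proof.
move=> a; elim/quotW => h; elim/quotW => k.
by rewrite (pi_scale a h) (pi_scale a k) -!pi_add (pi_scale a (h + k)) scalerDr.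
Qed.
Fact coh_scaleDl h : {morph coh_scale^~ h : a b / a + b}.
Proof. by elim/quotW: h => h a b; rewrite !pi_scale scalerDl pi_add. Qed.
HB.instance Definition _ :=
  GRing.Zmodule_isLmodule.Build F cohomology coh_scaleA coh_scale1 coh_scaleDr coh_scaleDl.

Fact coh_mulA : associative coh_mul.
Proof.
by elim/quotW => a; elim/quotW => b; elim/quotW => c; rewrite (pi_mul a b) (pi_mul b c) !pi_mul mulrA.
Qed.
Fact coh_mul1 : left_id coh_one coh_mul.
Proof. by elim/quotW => a; rewrite pi_mul mul1r. Qed.
Fact coh_mulr1 : right_id coh_one coh_mul.
Proof. by elim/quotW => a; rewrite pi_mul mulr1. Qed.
Fact coh_mulDl : left_distributive coh_mul +%R.
Proof.
elim/quotW => a; elim/quotW => b; elim/quotW => c.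
by rewrite (pi_mul a c) (pi_mul b c) -!pi_add pi_mul mulrDl.
Qed.
Fact coh_mulDr : right_distributive coh_mul +%R.
Proof.
elim/quotW => a; elim/quotW => b; elim/quotW => c.
by rewrite (pi_mul a b) (pi_mul a c) -!pi_add pi_mul mulrDr.
Qed.
Fact coh_one_neq0 : coh_one != 0.
Proof.
apply/eqP; rewrite -[0](raddf0 (\pi_cohomology)) => /cohomology_eq[t /=].
rewrite subr0 => /(congr1 (hcomp 0)); rewrite hcomp1 hcomp0_dgad.
by apply/eqP/oner_neq0.
Qed.
HB.instance Definition _ := GRing.Zmodule_isNzRing.Build cohomology
  coh_mulA coh_mul1 coh_mulr1 coh_mulDl coh_mulDr coh_one_neq0.

Fact coh_scaleAl (a : F) (h k : cohomology) : a *: (h * k) = a *: h * k.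
Proof.
elim/quotW: h => h; elim/quotW: k => k.
rewrite -[LHS]/(coh_scale a (coh_mul _ _)) -[RHS]/(coh_mul (coh_scale _ _) _).
by rewrite (pi_mul h k) (pi_scale a) ?(pi_scale a) pi_mul scalerAl.
Qed.
HB.instance Definition _ := GRing.Lmodule_isLalgebra.Build F cohomology coh_scaleAl.
Fact coh_scaleAr (a : F) (h k : cohomology) : a *: (h * k) = h * (a *: k).
Proof.
elim/quotW: h => h; elim/quotW: k => k.
rewrite -[LHS]/(coh_scale a (coh_mul _ _)) -[RHS]/(coh_mul _ (coh_scale _ _)).
by rewrite (pi_mul h k) (pi_scale a) ?(pi_scale a) pi_mul scalerAr.
Qed.
HB.instance Definition _ := GRing.Lalgebra_isAlgebra.Build F cohomology coh_scaleAr.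

Fact cocycle_hcomp n (z : cocycles) : hcomp n (val z) \in cocycle.
Proof. by rewrite unfold_in -hcompS_dgad (eqP (valP z)) linear0. Qed.

Definition coh_hcomp n (h : cohomology) : cohomology :=
  \pi_cohomology (Cocycle (cocycle_hcomp n (repr h))).

Lemma pi_hcomp n (z : cocycles) :
  coh_hcomp n (\pi_cohomology z) = \pi_cohomology (Cocycle (cocycle_hcomp n z)).
Proof.
apply/cohomology_eq; have [t tE] := reprD z; rewrite /= -linearB /= tE.
case: n => [|n]; first by exists 0; rewrite hcomp0_dgad linear0.
by exists (hcomp n t); rewrite hcompS_dgad.
Qed.

Lemma pi_sum (I : Type) (r : seq I) (f : I -> cocycles) :
  \pi_cohomology (\sum_(i <- r) f i) = \sum_(i <- r) \pi_cohomology (f i).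
Proof. exact: raddf_sum. Qed.

Fact coh_hcomp_linear n : linear (coh_hcomp n).
Proof.
move=> a; elim/quotW => x; elim/quotW => y.
rewrite -[a *: _]/(coh_scale a _) -[a *: coh_hcomp _ _]/(coh_scale a _).
rewrite (pi_scale a x) -pi_add !pi_hcomp pi_scale -pi_add.
by congr \pi_cohomology; apply/val_inj; rewrite /= linearP.
Qed.
Fact coh_hcomp_hcomp m n h :
  coh_hcomp m (coh_hcomp n h) = if m == n then coh_hcomp n h else 0.
Proof.
elim/quotW: h => x; rewrite (pi_hcomp n x) pi_hcomp.
transitivity (\pi_cohomology (if m == n then Cocycle (cocycle_hcomp n x) else 0)).
  congr \pi_cohomology; apply/val_inj; rewrite /= hcomp_hcomp.
  by case: eqP => // _; rewrite raddf0.
by case: eqP => // _; rewrite raddf0.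
Qed.
Fact coh_hcomp_sum h : exists N, h = \sum_(i < N) coh_hcomp i h.
Proof.
elim/quotW: h => x; have [N xE] := hcomp_sum (val x); exists N.
under eq_bigr do rewrite pi_hcomp.
rewrite -pi_sum; congr \pi_cohomology; apply/val_inj.
by rewrite raddf_sum {1}xE.
Qed.
Fact coh_hcomp_mul m n h k : coh_hcomp m h = h -> coh_hcomp n k = k ->
  coh_hcomp (m + n)%N (h * k) = h * k.
Proof.
elim/quotW: h => x; elim/quotW: k => y; rewrite (pi_hcomp m x) (pi_hcomp n y).
move=> <- <-; rewrite -[_ * _]/(coh_mul _ _) pi_mul pi_hcomp.
congr \pi_cohomology; apply/val_inj => /=.
by apply: hcomp_mul; rewrite hcomp_hcomp eqxx.
Qed.
Fact coh_hcomp1 : coh_hcomp 0 1 = 1.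
Proof.
rewrite -[1]/(\pi_cohomology 1) pi_hcomp; congr \pi_cohomology.
by apply/val_inj; rewrite /= hcomp1.
Qed.
Fact coh_hcomp0_scalar h : exists c : F, coh_hcomp 0 h = c%:A.
Proof.
elim/quotW: h => x; have [c cE] := hcomp0_scalar (val x); exists c.
rewrite -[c%:A]/(coh_scale c (\pi_cohomology 1)) pi_scale pi_hcomp.
by congr \pi_cohomology; apply/val_inj; rewrite /= cE.
Qed.
HB.instance Definition _ := Algebra_isConnectedGraded.Build F cohomology
  coh_hcomp_linear coh_hcomp_hcomp coh_hcomp_sum coh_hcomp_mul coh_hcomp1
  coh_hcomp0_scalar.

(* The class [z] of a cocycle z (a junk value when z is not a cocycle). *)
Definition coh_class (z : A) : cohomology := \pi_cohomology (insubd 0 z).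

End Cohomology.

Section GradedMaps.
Variables (F : fieldType) (A B : gradedAlgType F).

(* Graded linear maps A^{(x) n} -> B of degree s.  They are encoded as n-linear
   functions f on lists [:: a_1; ...; a_n] of elements of A; the value 0 on
   lists of other lengths makes the encoding unique. *)
Definition graded_map (n : nat) (s : int) (f : seq A -> B) : Prop :=
  [/\ forall l, size l <> n -> f l = 0,
      forall l1 l2, (size l1 + size l2).+1 = n ->
        linear (fun x => f (l1 ++ x :: l2))
    & forall (k : nat -> nat) l, size l = n ->
        (forall i, (i < n)%N -> homog (k i) l`_i) ->
        homog ((\sum_(i < n) k i)%N%:Z + s) (f l)].

Lemma homogB (C : gradedAlgType F) k (x y : C) :
  homog k x -> homog k y -> homog k (x - y).
Proof.
by case: k => n /= hx hy; rewrite ?linearB /= hx hy // subr0.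
Qed.

Lemma homog0 (C : gradedAlgType F) k : homog k (0 : C).
Proof. by case: k => n //=; rewrite linear0. Qed.

Lemma graded_map0 n s : graded_map n s (fun=> 0).
Proof.
split=> // [l1 l2 _ a x y|k l _ _]; first by rewrite scaler0 addr0.
exact: homog0.
Qed.

Lemma graded_mapB n s f g : graded_map n s f -> graded_map n s g ->
  graded_map n s (f - g).
Proof.
move=> [f0 fl fh] [g0 gl gh]; split=> [l ln|l1 l2 ln a x y|k l ln lh].
- by rewrite -[LHS]/(f l - g l) f0 // g0 // subr0.
- rewrite -[LHS]/(f _ - g _) fl // gl //.
  rewrite -![(f - g) _]/(f _ - g _).
  by rewrite scalerBr opprD addrACA.
- by apply: homogB; [exact: fh|exact: gh].
Qed.

End GradedMaps.

(* contract op i [:: a_0; ...; a_m] merges a_i and a_(i+1) into op a_i a_(i+1). *)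
Definition contract (T : Type) (op : T -> T -> T) (i : nat) (l : seq T) : seq T :=
  if drop i l is a :: b :: l' then take i l ++ op a b :: l' else l.

Section Hochschild.
Variables (F : fieldType) (A : gradedAlgType F).

(* a |-> (-1)^{s |a|} a, extended linearly from homogeneous elements. *)
Definition koszul (s : int) (a : A) : A :=
  \sum_(n \in [set: nat]) ((-1 : F) ^ (s * n%:Z)) *: hcomp n a.

Lemma koszul_homog s (n : nat) a : hcomp n a = a ->
  koszul s a = (-1 : F) ^ (s * n%:Z) *: a.
Proof.
move=> an; rewrite /koszul -(fsbig_widen [set n] setT) //=.
  by rewrite fsbig_set1 an.
move=> m [_ /= mn]; rewrite -an hcomp_hcomp.
by case: eqP mn => // _ _; rewrite scaler0.
Qed.

(* The index i of the sum starts at 0, hence the sign (-1)^(i+1). *)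
Definition hdiff (s : int) (f : seq A -> A) (l : seq A) : A :=
  if l is a :: t then
    koszul s a * f t
    + \sum_(i < size t) (-1) ^+ i.+1 *: f (contract *%R i l)
    + (-1) ^+ size l *: (f (take (size t) l) * last a t)
  else 0.

Lemma hdiffB s f g : hdiff s (f - g) = hdiff s f - hdiff s g.
Proof.
apply/funext => -[|a t]; first by rewrite -[RHS]/(0 - 0) subrr.
rewrite -[RHS]/(hdiff s f (a :: t) - hdiff s g (a :: t)) /hdiff.
have E l : (f - g) l = f l - g l by [].
rewrite !E mulrBr mulrBl scalerBr; under eq_bigr do rewrite E scalerBr.
by rewrite sumrB [X in X + _ = _]addrACA [LHS]addrACA -!opprD.
Qed.

(* HH^{n,s}(A) = HH^{n,s}(A, A): cocycles in C^{n,s} = {f | graded_map n s f}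
   modulo the image of C^{n-1,s}, which is 0 when n = 0. *)
Definition hcocycle (n : nat) (s : int) : {pred seq A -> A} :=
  fun f => `[< graded_map n s f /\ hdiff s f = 0 >].

Fact hcocycle_zmod n s : zmod_closed (hcocycle n s).
Proof.
have h0 : hdiff s 0 = 0 by rewrite -[X in hdiff s X](subrr 0) hdiffB subrr.
split=> [|f g /asboolP[fm f0] /asboolP[gm g0]]; apply/asboolP.
  by split=> //; exact: graded_map0.
by split; [exact: graded_mapB|rewrite hdiffB f0 g0 subrr].
Qed.
HB.instance Definition _ n s :=
  GRing.isZmodClosed.Build (seq A -> A) (hcocycle n s) (hcocycle_zmod n s).

Record hcocycles (n : nat) (s : int) :=
  HCocycle { hcocycle_val :> seq A -> A; hcocycleP : hcocycle_val \in hcocycle n s }.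
HB.instance Definition _ n s := [isSub for @hcocycle_val n s].
HB.instance Definition _ n s := [Choice of hcocycles n s by <:].
HB.instance Definition _ n s := [SubChoice_isSubZmodule of hcocycles n s by <:].

Definition hcoboundary (n : nat) (s : int) : {pred hcocycles n s} :=
  fun c => `[< if n is m.+1 then
                 exists2 g, graded_map m s g & val c = hdiff s g
               else val c = 0 >].

Fact hcoboundary_zmod n s : zmod_closed (@hcoboundary n s).
Proof.
have h0 : hdiff s 0 = 0 by rewrite -[X in hdiff s X](subrr 0) hdiffB subrr.
case: n => [|n]; split=> [|x y /asboolP xb /asboolP yb]; apply/asboolP.
- exact: raddf0.
- by rewrite [LHS]raddfB /= -[hcocycle_val x]/(val x) -[hcocycle_val y]/(val y) xb yb subrr.
- by exists 0; [exact: graded_map0|rewrite h0 raddf0].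
case: xb yb => [f fm fE] [g gm gE]; exists (f - g).
  exact: graded_mapB.
by rewrite hdiffB -fE -gE; exact: raddfB.
Qed.
HB.instance Definition _ n s :=
  GRing.isZmodClosed.Build (hcocycles n s) (@hcoboundary n s) (hcoboundary_zmod n s).

Definition HH (n : nat) (s : int) := {ideal_quot (@hcoboundary n s)}.
HB.instance Definition _ n s := GRing.Zmodule.on (HH n s).
HB.instance Definition _ n s := EqQuotient.on (HH n s).

Definition HH_class n s (c : hcocycles n s) : HH n s := \pi_(HH n s) c.

End Hochschild.

Section Formality.
Variables (F : fieldType) (A : dgaType F).
Local Notation H := (cohomology A).
Implicit Types f : seq H -> A.

Definition A3_eq2 f1 f2 := forall x y : H,
  dgad (f2 [:: x; y]) = f1 [:: x * y] - f1 [:: x] * f1 [:: y].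

(* By linearity the equation for f2 need not be restricted to homogeneous
   elements; the one for f3 involves the sign (-1)^|x|. *)
Definition A3_formal : Prop :=
  exists f1 f2 f3 : seq H -> A,
  [/\ graded_map 1 0 f1, graded_map 2 (-1) f2 & graded_map 3 (-2) f3] /\
  [/\ forall x, dgad (f1 [:: x]) = 0,
      bijective (fun x => coh_class (f1 [:: x])),
      A3_eq2 f1 f2
    & forall (i j k : nat) (x y z : H), homog i x -> homog j y -> homog k z ->
        dgad (f3 [:: x; y; z]) + (-1) ^+ i *: (f1 [:: x] * f2 [:: y; z])
          - f2 [:: x; y] * f1 [:: z]
        = f2 [:: x * y; z] - f2 [:: x; y * z]].

Definition Phi3 f1 f2 (i : nat) (x y z : H) : A :=
  (-1) ^+ i *: (f1 [:: x] * f2 [:: y; z]) - f2 [:: x; y] * f1 [:: z]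
  - f2 [:: x * y; z] + f2 [:: x; y * z].

Definition canonical_choice f1 f2 : Prop :=
  [/\ graded_map 1 0 f1, graded_map 2 (-1) f2,
      forall x, dgad (f1 [:: x]) = 0,
      forall x, coh_class (f1 [:: x]) = x
    & A3_eq2 f1 f2].

(* Phi3 f1 f2 |x| x y z is a cocycle whenever canonical_choice f1 f2 holds. *)
Definition canonical_rep f1 f2 (m3 : hcocycles H 3 (-1)) : Prop :=
  forall (i j k : nat) (x y z : H), homog i x -> homog j y -> homog k z ->
    val m3 [:: x; y; z] = coh_class (Phi3 f1 f2 i x y z).

(* The class [m_3] does not depend on f1 and f2, and such f1 and f2 exist, so
   the set below is a singleton and the default value of xget is not used. *)
Definition canonical_class : HH H 3 (-1) :=
  xget 0 [set c | exists f1 f2 m3,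
    [/\ canonical_choice f1 f2, canonical_rep f1 f2 m3 & c = HH_class m3]]%classic.

End Formality.

HB.mixin Record Topological_isTopGroup G of Group G & Topological G := {
  mulg_continuous : continuous (fun z : G * G => (z.1 * z.2)%g);
  invg_continuous : continuous (fun x : G => (x^-1)%g);
}.

#[short(type="topGroupType")]
HB.structure Definition TopGroup :=
  {G of Group G & Topological G & Topological_isTopGroup G}.

Section RawCochains.
Variables (G : groupType) (F : fieldType).
Implicit Types (phi psi : seq G -> F) (s t : seq G) (g h : G).

(* An inhomogeneous n-cochain is a function on lists [:: g_1; ...; g_n]; the
   index i of the sum starts at 0. *)
Definition cdiff phi s : F :=
  if s is _ :: t then
    phi t + \sum_(i < size t) (-1) ^+ i.+1 * phi (contract (fun a b => a * b)%g i s)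
    + (-1) ^+ size s * phi (take (size t) s)
  else 0.

Definition cup phi psi s : F :=
  \sum_(i < (size s).+1) phi (take i s) * psi (drop i s).

Let sl phi g : seq G -> F := fun t => phi (g :: t).

Lemma contract0 (T : Type) op (a b : T) l : contract op 0 (a :: b :: l) = op a b :: l.
Proof. by rewrite /contract drop0. Qed.

Lemma contractS (T : Type) op (a : T) i l :
  contract op i.+1 (a :: l) = a :: contract op i l.
Proof. by rewrite /contract /=; case: drop => [|b [|c l']]. Qed.

Lemma cdiff1 phi g : cdiff phi [:: g] = 0.
Proof. by rewrite /cdiff /= big_ord0 addr0 expr1 mulN1r subrr. Qed.

Lemma cdiff_cons2 phi g h s : cdiff phi (g :: h :: s) =
  phi (h :: s) - phi ((g * h)%g :: s) + phi (g :: s) - cdiff (sl phi g) (h :: s).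
Proof.
rewrite /cdiff [size (h :: s)]/= big_ord_recl contract0 expr1 mulN1r.
under eq_bigr => i _ do rewrite lift0 contractS exprS mulN1r mulNr.
rewrite sumrN /sl /= (exprS _ (size s).+1) mulN1r.
by set S := \sum_(i < _) _; ring.
Qed.

Lemma cup_nil phi psi : cup phi psi [::] = phi [::] * psi [::].
Proof. by rewrite /cup big_ord_recl big_ord0 addr0. Qed.

Lemma cup_cons phi psi g s :
  cup phi psi (g :: s) = phi [::] * psi (g :: s) + cup (sl phi g) psi s.
Proof. by rewrite /cup big_ord_recl. Qed.

Lemma eq_cup phi phi' psi psi' s : phi =1 phi' -> psi =1 psi' ->
  cup phi psi s = cup phi' psi' s.
Proof. by move=> e e'; apply: eq_bigr => i _; rewrite e e'. Qed.

Lemma eq_cdiff phi phi' s : phi =1 phi' -> cdiff phi s = cdiff phi' s.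
Proof.
move=> e; case: s => //= a t; rewrite !e; congr (_ + _ + _).
by apply: eq_bigr => i _; rewrite e.
Qed.

Lemma cup_lin a phi phi' psi s :
  cup (fun t => a * phi t + phi' t) psi s = a * cup phi psi s + cup phi' psi s.
Proof.
by rewrite /cup mulr_sumr -big_split; apply: eq_bigr => i _ /=; rewrite mulrDl mulrA.
Qed.

Lemma cup_linr a phi psi psi' s :
  cup phi (fun t => a * psi t + psi' t) s = a * cup phi psi s + cup phi psi' s.
Proof.
rewrite /cup mulr_sumr -big_split; apply: eq_bigr => i _ /=.
by rewrite mulrDr mulrCA.
Qed.

Lemma cdiff_lin a phi psi s :
  cdiff (fun t => a * phi t + psi t) s = a * cdiff phi s + cdiff psi s.
Proof.
case: s => [|g t] /=; first by rewrite mulr0 addr0.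
rewrite (eq_bigr (fun i : 'I_(size t) =>
    a * ((-1) ^+ i.+1 * phi (contract (fun a b => a * b)%g i (g :: t)))
    + (-1) ^+ i.+1 * psi (contract (fun a b => a * b)%g i (g :: t)))); last first.
  by move=> i _; ring.
rewrite big_split -mulr_sumr /=; ring.
Qed.

Lemma cupA phi psi chi s : cup phi (cup psi chi) s = cup (cup phi psi) chi s.
Proof.
elim: s phi psi => [|g s IH] phi psi; first by rewrite !cup_nil mulrA.
rewrite !cup_cons cup_nil IH mulrDr mulrA.
rewrite -addrA; congr (_ + _).
have e1 : sl (cup phi psi) g =1
    fun t => phi [::] * sl psi g t + cup (sl phi g) psi t.
  by move=> t; rewrite /sl cup_cons.
by rewrite (eq_cup _ e1 (frefl _)) cup_lin.
Qed.

Lemma cdiffK phi s : cdiff (cdiff phi) s = 0.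
Proof.
elim: s phi => [|g [|h [|k s]] IH] phi //; first by rewrite cdiff1.
  by rewrite cdiff_cons2 !cdiff1 subrr add0r subr0.
rewrite cdiff_cons2.
have IHg := IH (sl phi g); rewrite cdiff_cons2 in IHg.
set X := sl (cdiff phi) g.
have XE : sl X h =1 (fun t => -1 * (sl (cdiff (sl phi g)) h) t +
    (1 * sl phi g t + (-1 * sl phi (g * h)%g t + sl phi h t))).
  by move=> t; rewrite /X /sl cdiff_cons2 /sl; ring.
rewrite (cdiff_cons2 X) (eq_cdiff _ XE) !cdiff_lin.
rewrite /X /sl !(cdiff_cons2 phi) mulgA.
move/eqP: IHg; rewrite subr_eq add0r => /eqP <-; rewrite /sl; ring.
Qed.

Definition eps phi : seq G -> F := fun t => (-1) ^+ size t * phi t.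

Lemma cdiff_cup phi psi s :
  cdiff (cup phi psi) s = cup (cdiff phi) psi s + cup (eps phi) (cdiff psi) s.
Proof.
elim: s phi => [|g [|h s] IH] phi.
- by rewrite !cup_nil /= mul0r mulr0 addr0.
- by rewrite !cup_cons !cup_nil /sl !cdiff1 /= !mul0r !mulr0 !addr0.
rewrite cdiff_cons2.
have e1 : sl (cup phi psi) g =1
    fun t => phi [::] * sl psi g t + cup (sl phi g) psi t.
  by move=> t; rewrite /sl cup_cons.
rewrite (eq_cdiff _ e1) cdiff_lin IH !cup_cons.
have -> : sl (cdiff phi) g [::] = 0 by rewrite /sl cdiff1.
have -> : eps phi [::] = phi [::] by rewrite /eps mul1r.
have -> : sl (eps phi) g [::] = - sl phi g [::] by rewrite /sl /eps expr1 mulN1r.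
have -> : eps (sl phi g) [::] = sl phi g [::] by rewrite /eps mul1r.
have cdiff0 chi : cdiff chi [::] = 0 by [].
rewrite !cdiff0.
have e2 : sl (sl (cdiff phi) g) h =1 fun t => -1 * (sl (cdiff (sl phi g)) h) t +
    (1 * sl phi g t + (-1 * sl phi (g * h)%g t + sl phi h t)).
  by move=> t; rewrite /sl cdiff_cons2 /sl; ring.
rewrite (eq_cup _ e2 (frefl _)) !cup_lin.
have e3 : sl (sl (eps phi) g) h =1 fun t => -1 * sl (eps (sl phi g)) h t + 0.
  by move=> t; rewrite /sl /eps /= !exprS; ring.
rewrite (eq_cup _ e3 (frefl _)) cup_lin cdiff_cons2.
have -> : cup (fun=> 0) (cdiff psi) s = 0.
  by rewrite /cup big1 // => i _; rewrite mul0r.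
by rewrite /sl; ring.
Qed.

End RawCochains.

Section Cochains.
Variables (G : topGroupType) (F : fieldType).
Implicit Types (phi psi : seq G -> F^o).

(* The restriction to lists of length n is continuous on G^n for every n, where
   F is discrete. *)
Definition continuous_cochain phi : Prop :=
  forall n, continuous (fun v : {ptws 'I_n -> G} =>
    (phi [seq v i | i : 'I_n] : discrete_topology F)).

Lemma discreteP (X : topologicalType) (f : X -> discrete_topology F) :
  continuous f <-> forall x, \forall y \near x, f y = f x.
Proof.
split=> [fc x|fc x].
  by have /discrete_cvg := fc x; apply.
by apply/discrete_cvg; exact: fc.
Qed.

Lemma comp_cochain phi : continuous_cochain phi ->
  forall (X : topologicalType) (L : X -> seq G) n,
  (forall x, size (L x) = n) ->
  (forall i, (i < n)%N -> continuous (fun x => nth 1%g (L x) i)) ->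
  forall x, \forall y \near x, phi (L y) = phi (L x).
Proof.
move=> phic X L n Ln Lc x.
pose V (y : X) : {ptws 'I_n -> G} := fun i => nth 1%g (L y) i.
have VE y : L y = [seq V y i | i : 'I_n].
  apply: (@eq_from_nth _ 1%g); first by rewrite size_map size_enum_ord Ln.
  move=> i; rewrite Ln => ilt; rewrite (nth_map (Ordinal ilt)) ?size_enum_ord //.
  by rewrite /V nth_enum_ord.
have Vc : continuous V.
  move=> y; apply/cvg_sup => i; apply/cvg_image => //.
    by apply/seteqP; split=> // a _; exists (fun=> a).
  have := Lc i (ltn_ord i) y.
  move=> h U /h; rewrite /= nbhs_filterE => hU.
  exists [set v : 'I_n -> G | U (v i)]; first exact: hU.
  apply/seteqP; split=> [a [v /= Uv <-]//|a Ua]; by exists (fun=> a).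
have /discreteP h := phic n.
have := Vc x _ (h (V x)); rewrite nbhs_filterE /=.
by apply: filterS => y /=; rewrite -!VE.
Qed.

Lemma near_eq_sum (X : topologicalType) (x : X) (I : Type) (r : seq I)
    (f : I -> X -> F) : (forall i, \forall y \near x, f i y = f i x) ->
  \forall y \near x, \sum_(i <- r) f i y = \sum_(i <- r) f i x.
Proof.
move=> fx; elim: r => [|i r IH]; first by apply: nearW => y; rewrite !big_nil.
have fi := fx i; near=> y; rewrite !big_cons; congr (_ + _); near: y.
  exact: fi.
exact: IH.
Unshelve. all: by end_near. Qed.

Lemma nth_contract (i : nat) (l : seq G) (j : nat) :
  (i.+1 < size l)%N ->
  nth 1%g (contract (fun a b => (a * b)%g) i l) j =
  if (j < i)%N then nth 1%g l j
  else if j == i then (nth 1%g l i * nth 1%g l i.+1)%g else nth 1%g l j.+1.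
Proof.
elim: i l j => [|i IH] [|a [|b l]] [|j] //= il; rewrite ?contract0 ?contractS //=.
by rewrite IH // ltnS eqSS.
Qed.

Lemma size_contract (i : nat) (l : seq G) : (i.+1 < size l)%N ->
  size (contract (fun a b => (a * b)%g) i l) = (size l).-1.
Proof.
elim: i l => [|i IH] [|a [|b l]] //= il; rewrite ?contract0 ?contractS //=.
by rewrite IH.
Qed.

Let lst n (v : {ptws 'I_n -> G}) := [seq v i | i : 'I_n].

Lemma size_lst n (v : {ptws 'I_n -> G}) : size (lst v) = n.
Proof. by rewrite size_map size_enum_ord. Qed.

Lemma cst_continuous' (X Y : topologicalType) (y : Y) : continuous (fun _ : X => y).
Proof. by move=> x; exact: cvg_cst. Qed.

Lemma nth_lst_continuous n i : continuous (fun v : {ptws 'I_n -> G} => nth 1%g (lst v) i).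
Proof.
have [ilt|ige] := ltnP i n; last first.
  have -> : (fun v : {ptws 'I_n -> G} => nth 1%g (lst v) i) = fun=> 1%g.
    by apply/funext => v; rewrite nth_default // size_lst.
  exact: cst_continuous'.
have -> : (fun v : {ptws 'I_n -> G} => nth 1%g (lst v) i) = fun v => v (Ordinal ilt).
  apply/funext => v; rewrite (nth_map (Ordinal ilt)) ?size_enum_ord //.
  by congr (v _); apply/val_inj; rewrite /= nth_enum_ord.
exact: (@proj_continuous _ (fun=> G) (Ordinal ilt)).
Qed.

Lemma mulg_fun_continuous (X : topologicalType) (f g : X -> G) :
  continuous f -> continuous g -> continuous (fun x => (f x * g x)%g).
Proof.
move=> fc gc x; apply: (@continuous2_cvg _ G G G _ _ f g (fun a b => (a * b)%g) (f x) (g x)).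
- exact: (@mulg_continuous G (f x, g x)).
- exact: fc.
- exact: gc.
Qed.

Lemma cup_continuous phi psi : continuous_cochain phi -> continuous_cochain psi ->
  continuous_cochain (cup phi psi : seq G -> F).
Proof.
move=> phic psic n; apply/discreteP => x; rewrite /cup !size_lst.
have: \forall y \near x, \sum_(i < n.+1) phi (take i (lst y)) * psi (drop i (lst y))
    = \sum_(i < n.+1) phi (take i (lst x)) * psi (drop i (lst x)).
  apply: near_eq_sum => i.
  have h1 : \forall y \near x, phi (take i (lst y)) = phi (take i (lst x)).
    apply: (comp_cochain phic (L := fun y => take i (lst y)) (n := minn i n)).
      by move=> v; rewrite size_take_min size_lst.
    move=> j; rewrite leq_min => /andP[ji _].
    have -> : (fun v => nth 1%g (take i (lst v)) j) =
        (fun v : {ptws 'I_n -> G} => nth 1%g (lst v) j).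
      by apply/funext => v; rewrite nth_take.
    exact: nth_lst_continuous.
  have h2 : \forall y \near x, psi (drop i (lst y)) = psi (drop i (lst x)).
    apply: (comp_cochain psic (L := fun y => drop i (lst y)) (n := (n - i)%N)).
      by move=> v; rewrite size_drop size_lst.
    move=> j _.
    have -> : (fun v => nth 1%g (drop i (lst v)) j) =
        (fun v : {ptws 'I_n -> G} => nth 1%g (lst v) (i + j)).
      by apply/funext => v; rewrite nth_drop.
    exact: nth_lst_continuous.
  near=> y; congr (_ * _); near: y; [exact: h1|exact: h2].
by apply: filterS => y; rewrite size_lst.
Unshelve. all: by end_near. Qed.

Lemma cdiff_continuous phi : continuous_cochain phi ->
  continuous_cochain (cdiff phi : seq G -> F).
Proof.
move=> phic [|n]; apply/discreteP => x.
  by near=> y; rewrite -!/(lst _) !(size0nil (size_lst _)).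
have cE (y : {ptws 'I_n.+1 -> G}) : cdiff phi (lst y) = phi (behead (lst y))
   + \sum_(i < n) (-1) ^+ i.+1 * phi (contract (fun a b => a * b)%g i (lst y))
   + (-1) ^+ n.+1 * phi (take n (lst y)).
  by have := size_lst y; case: (lst y) => // a t [<-].
have h1 : \forall y \near x, phi (behead (lst y)) = phi (behead (lst x)).
  apply: (comp_cochain phic (L := fun y => behead (lst y)) (n := n)).
    by move=> v; rewrite size_behead size_lst.
  move=> j _.
  have -> : (fun v => nth 1%g (behead (lst v)) j) =
      (fun v : {ptws 'I_n.+1 -> G} => nth 1%g (lst v) j.+1).
    by apply/funext => v; rewrite nth_behead.
  exact: nth_lst_continuous.
have h2 : \forall y \near x, phi (take n (lst y)) = phi (take n (lst x)).
  apply: (comp_cochain phic (L := fun y => take n (lst y)) (n := n)).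
    by move=> v; rewrite size_takel // size_lst.
  move=> j jn.
  have -> : (fun v => nth 1%g (take n (lst v)) j) =
      (fun v : {ptws 'I_n.+1 -> G} => nth 1%g (lst v) j).
    by apply/funext => v; rewrite nth_take.
  exact: nth_lst_continuous.
have h3 : \forall y \near x,
   \sum_(i < n) (-1) ^+ i.+1 * phi (contract (fun a b => a * b)%g i (lst y))
   = \sum_(i < n) (-1) ^+ i.+1 * phi (contract (fun a b => a * b)%g i (lst x)).
  apply: near_eq_sum => i.
  have h : \forall y \near x, phi (contract (fun a b => a * b)%g i (lst y))
     = phi (contract (fun a b => a * b)%g i (lst x)).
    apply: (comp_cochain phic
      (L := fun y => contract (fun a b => a * b)%g i (lst y)) (n := n)).
      by move=> v; rewrite size_contract size_lst // ltnS.
    move=> j _.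
    have -> : (fun v => nth 1%g (contract (fun a b => a * b)%g i (lst v)) j) =
      (fun v : {ptws 'I_n.+1 -> G} => if (j < i)%N then nth 1%g (lst v) j
        else if j == i then (nth 1%g (lst v) i * nth 1%g (lst v) i.+1)%g
        else nth 1%g (lst v) j.+1).
      by apply/funext => v; rewrite nth_contract // size_lst ltnS.
    case: (j < i)%N; first exact: nth_lst_continuous.
    case: (j == i); last exact: nth_lst_continuous.
    by apply: mulg_fun_continuous; exact: nth_lst_continuous.
  by near=> y; congr (_ * _); near: y.
near=> y; rewrite !cE; congr (_ + _ + _ * _); near: y;
  [exact: h1|exact: h3|exact: h2].
Unshelve. all: by end_near. Qed.

(* The direct sum over n of the spaces of continuous cochains G^n -> F: a
   function on lists of all lengths, vanishing on all sufficiently long lists.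
   Its degree n component is the restriction to lists of length n. *)
Definition cochain : {pred seq G -> F^o} := fun phi =>
  `[< (exists N, forall s, (N <= size s)%N -> phi s = 0)
      /\ continuous_cochain phi >].

Fact cochain_submod : submod_closed cochain.
Proof.
split=> [|a phi psi /asboolP[[N phi0] phic] /asboolP[[M psi0] psic]]; apply/asboolP.
  split; first by exists 0.
  by move=> n; apply/discreteP => x; near=> y.
split.
  exists (maxn N M) => s; rewrite geq_max => /andP[Ns Ms].
  by rewrite -[LHS]/(a * phi s + psi s) phi0 // psi0 // mulr0 addr0.
move=> n; apply/discreteP => x.
have /discreteP/(_ x) h1 := phic n; have /discreteP/(_ x) h2 := psic n.
near=> y; rewrite -[LHS]/(a * phi (lst y) + psi (lst y)).
have -> : phi (lst y) = phi (lst x) by near: y.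
by have -> : psi (lst y) = psi (lst x) by near: y.
Unshelve. all: by end_near. Qed.
HB.instance Definition _ := GRing.isSubmodClosed.Build F _ cochain cochain_submod.

Record cochains := Cochain { cochain_val :> seq G -> F^o; cochainP : cochain_val \in cochain }.
HB.instance Definition _ := [isSub for cochain_val].
HB.instance Definition _ := [Choice of cochains by <:].
HB.instance Definition _ := [SubChoice_isSubLmodule of cochains by <:].

Implicit Types a b c : cochains.

Lemma cochain_bounded a : exists N, forall s, (N <= size s)%N -> a s = 0.
Proof. by have /asboolP[] := cochainP a. Qed.

Lemma cochain_continuous a : continuous_cochain a.
Proof. by have /asboolP[] := cochainP a. Qed.

Lemma cochain_ext a b : (forall s, a s = b s) -> a = b.
Proof. by move=> ab; apply/val_inj/funext. Qed.

Fact cochain_unit_subproof : (fun s => (nilp s)%:R : F) \in cochain.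
Proof.
apply/asboolP; split; first by exists 1 => -[].
by move=> n; apply/discreteP => x; near=> y; rewrite /nilp !(size_lst _).
Unshelve. all: by end_near. Qed.
Definition cochain_unit := Cochain cochain_unit_subproof.

Fact cochain_cup_subproof a b : (cup a b : seq G -> F) \in cochain.
Proof.
apply/asboolP; split; last exact: cup_continuous (@cochain_continuous a) (@cochain_continuous b).
have [N aN] := cochain_bounded a; have [M bM] := cochain_bounded b.
exists (N + M)%N => s sNM; rewrite /cup big1 // => -[i /= il] _.
have [Ni|iN] := leqP N i; first by rewrite aN ?mul0r // size_takel.
rewrite bM ?mulr0 // size_drop leq_subRL //.
by rewrite (leq_trans _ sNM) // leq_add2r ltnW.
Qed.
Definition cochain_cup a b := Cochain (cochain_cup_subproof a b).

Fact cochain_diff_subproof a : (cdiff a : seq G -> F) \in cochain.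
Proof.
apply/asboolP; split; last exact: cdiff_continuous (@cochain_continuous a).
have [N aN] := cochain_bounded a; exists N.+1 => -[|g t] //= Nt.
rewrite aN // big1 => [|i _].
  by rewrite aN ?mulr0 ?addr0 // size_takel /= ?leqnSn.
by rewrite aN ?mulr0 // size_contract //= ltnS.
Qed.
Definition cochain_diff a := Cochain (cochain_diff_subproof a).

Fact cochain_hcomp_subproof n a : (fun s => (if size s == n then a s else 0) : F) \in cochain.
Proof.
apply/asboolP; split.
  by have [N aN] := cochain_bounded a; exists N => s /aN ->; rewrite if_same.
move=> m; apply/discreteP => x; rewrite !(size_lst _).
have /discreteP/(_ x) h := @cochain_continuous a m.
by near=> y; rewrite (size_lst y); case: ifP => // _; near: y.
Unshelve. all: by end_near. Qed.
Definition cochain_hcomp n a := Cochain (cochain_hcomp_subproof n a).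

Fact cochain_cupA : associative cochain_cup.
Proof. by move=> a b c; apply: cochain_ext => s; exact: cupA. Qed.
Fact cochain_cup1 : left_id cochain_unit cochain_cup.
Proof.
move=> a; apply: cochain_ext => s; rewrite /= /cup big_ord_recl take0 drop0 mul1r.
rewrite big1 ?addr0 // => i _; case: s i => [[]//|g s] i.
by rewrite /= mul0r.
Qed.
Fact cochain_cupr1 : right_id cochain_unit cochain_cup.
Proof.
move=> a; apply: cochain_ext => s; rewrite /= /cup big_ord_recr /=.
rewrite take_size drop_size mulr1 big1 ?add0r // => i _.
by rewrite /nilp size_drop subn_eq0 leqNgt ltn_ord mulr0.
Qed.
Fact cochain_cupDl : left_distributive cochain_cup +%R.
Proof.
move=> a b c; apply: cochain_ext => s.
rewrite -[RHS]/(cup a c s + cup b c s).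
have := cup_lin 1 a b c s; rewrite mul1r => <-.
by apply: eq_cup => // t; rewrite mul1r.
Qed.
Fact cochain_cupDr : right_distributive cochain_cup +%R.
Proof.
move=> a b c; apply: cochain_ext => s.
rewrite -[RHS]/(cup a b s + cup a c s).
have := cup_linr 1 a b c s; rewrite mul1r => <-.
by apply: eq_cup => // t; rewrite mul1r.
Qed.
Fact cochain_unit_neq0 : cochain_unit != 0.
Proof.
apply/eqP => /(congr1 (fun a : cochains => a [::])) /= /eqP.
by rewrite oner_eq0.
Qed.
HB.instance Definition _ := GRing.Zmodule_isNzRing.Build cochains
  cochain_cupA cochain_cup1 cochain_cupr1 cochain_cupDl cochain_cupDr
  cochain_unit_neq0.

Fact cochain_scaleAl (k : F) a b : k *: (a * b) = k *: a * b.
Proof.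
apply: cochain_ext => s; rewrite -[LHS]/(k * cup a b s) -[RHS]/(cup _ b s).
by rewrite /cup mulr_sumr; apply: eq_bigr => i _; rewrite mulrA.
Qed.
HB.instance Definition _ := GRing.Lmodule_isLalgebra.Build F cochains cochain_scaleAl.
Fact cochain_scaleAr (k : F) a b : k *: (a * b) = a * (k *: b).
Proof.
apply: cochain_ext => s; rewrite -[LHS]/(k * cup a b s) -[RHS]/(cup a _ s).
by rewrite /cup mulr_sumr; apply: eq_bigr => i _; rewrite mulrCA.
Qed.
HB.instance Definition _ := GRing.Lalgebra_isAlgebra.Build F cochains cochain_scaleAr.

Fact cochain_hcomp_linear n : linear (cochain_hcomp n).
Proof.
move=> k a b; apply: cochain_ext => s.
rewrite -[RHS]/(k * (if size s == n then a s else 0) + if size s == n then b s else 0).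
by rewrite /=; case: ifP => // _; rewrite mulr0 addr0.
Qed.
Fact cochain_hcomp_hcomp m n a : cochain_hcomp m (cochain_hcomp n a) =
  if m == n then cochain_hcomp n a else 0.
Proof.
apply: cochain_ext => s /=; have [->|mn] := eqVneq m n.
  by rewrite /=; case: eqP => // ->; rewrite eqxx.
by case: eqP => // ->; rewrite (negbTE mn).
Qed.
Lemma cochain_sumE (I : Type) (r : seq I) (f : I -> cochains) s :
  (\sum_(i <- r) f i) s = \sum_(i <- r) f i s.
Proof. by elim: r => [|i r IH]; rewrite ?big_nil // !big_cons -IH. Qed.
Fact cochain_hcomp_sum a : exists N, a = \sum_(i < N) cochain_hcomp i a.
Proof.
have [N aN] := cochain_bounded a; exists N; apply: cochain_ext => s.
rewrite cochain_sumE /=; have [Ns|sN] := leqP N (size s).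
  by rewrite aN // big1 // => i _; rewrite if_same.
rewrite (bigD1 (Ordinal sN)) //= eqxx big1 ?addr0 // => i.
by rewrite -val_eqE /= eq_sym => /negbTE ->.
Qed.
Lemma cochain_hcompP n a : cochain_hcomp n a = a <-> forall s, size s <> n -> a s = 0.
Proof.
split=> [<- s /eqP/negbTE /= -> //|an]; apply: cochain_ext => s /=.
by case: eqP => // sn; rewrite an.
Qed.
Fact cochain_hcomp_mul m n a b : cochain_hcomp m a = a -> cochain_hcomp n b = b ->
  cochain_hcomp (m + n)%N (a * b) = a * b.
Proof.
move=> /cochain_hcompP am /cochain_hcompP bn; apply/cochain_hcompP => s smn.
rewrite -[LHS]/(cup a b s) /cup big1 // => -[i /=]; rewrite ltnS => il _.
have [im|im] := eqVneq i m; last first.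
  by rewrite am ?mul0r // size_takel //; apply/eqP.
rewrite bn ?mulr0 // size_drop im => sn; apply: smn.
by rewrite -sn subnKC // -im.
Qed.
Fact cochain_hcomp1 : cochain_hcomp 0 1 = 1.
Proof. by apply/cochain_hcompP => -[]. Qed.
Fact cochain_hcomp0_scalar a : exists k : F, cochain_hcomp 0 a = k%:A.
Proof.
exists (a [::]); apply: cochain_ext => s; rewrite -[RHS]/(a [::] * (nilp s)%:R) /=.
by case: s => [|g s]; rewrite /= ?mulr1 ?mulr0.
Qed.
HB.instance Definition _ := Algebra_isConnectedGraded.Build F cochains
  cochain_hcomp_linear cochain_hcomp_hcomp cochain_hcomp_sum cochain_hcomp_mul
  cochain_hcomp1 cochain_hcomp0_scalar.

Fact cochain_diff_linear : linear cochain_diff.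
Proof. by move=> k a b; apply: cochain_ext => s; exact: cdiff_lin. Qed.
Fact cochain_diff_hcomp n a : hcomp n a = a ->
  hcomp n.+1 (cochain_diff a) = cochain_diff a.
Proof.
move=> /cochain_hcompP an; apply/cochain_hcompP => -[|g t] //= tn.
have {}tn : size t <> n by move=> tE; apply: tn; rewrite tE.
rewrite an // big1 => [|i _].
  by rewrite an ?mulr0 ?addr0 // size_takel /= ?leqnSn.
by rewrite an ?mulr0 // size_contract //= ltnS.
Qed.
Fact cochain_diffK a : cochain_diff (cochain_diff a) = 0.
Proof. by apply: cochain_ext => s; exact: cdiffK. Qed.
Fact cochain_diffM n a b : hcomp n a = a ->
  cochain_diff (a * b) = cochain_diff a * b + (-1) ^+ n *: (a * cochain_diff b).
Proof.
move=> /cochain_hcompP an; apply: cochain_ext => s.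
rewrite -[RHS]/(cup (cdiff a) b s + (-1) ^+ n * cup a (cdiff b) s).
rewrite -[LHS]/(cdiff (cup a b) s) cdiff_cup; congr (_ + _).
rewrite /cup mulr_sumr; apply: eq_bigr => i _; rewrite /eps mulrA.
by have [->//|/eqP tn] := eqVneq (size (take i s)) n; rewrite an // !(mulr0, mul0r).
Qed.
HB.instance Definition _ := GradedAlgebra_isDGA.Build F cochains
  cochain_diff_linear cochain_diff_hcomp cochain_diffK cochain_diffM.

End Cochains.

Section ProPGroups.
Local Open Scope group_scope.

Definition normal_subgroup (G : groupType) (N : set G) : Prop :=
  [/\ N 1, forall x y, N x -> N y -> N (x / y)
    & forall x y, N x -> N (x ^ y)].

(* A profinite group all of whose open normal subgroups have index a power
   of p. *)
Definition pro_p_group (p : nat) (G : topGroupType) : Prop :=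
  [/\ compact [set: G], hausdorff_space G, totally_disconnected [set: G]
    & forall N : set G, open N -> normal_subgroup N ->
        exists k, (range (fun g : G => [set (g * n)%g | n in N]) #= `I_(p ^ k))%card].

Definition continuous_hom (G H : topGroupType) (phi : G -> H) : Prop :=
  {morph phi : a b / a * b} /\ continuous phi.

(* F is the free pro-p group on x_1, ..., x_d. *)
Definition free_pro_p (p d : nat) (F : topGroupType) (x : 'I_d -> F) : Prop :=
  pro_p_group p F /\
  forall (P : topGroupType) (y : 'I_d -> P), pro_p_group p P ->
    exists! phi : F -> P, continuous_hom phi /\ forall i, phi (x i) = y i.

Definition closed_normal_closure (G : topGroupType) (A : set G) : set G :=
  \bigcap_(N in [set N | [/\ normal_subgroup N, closed N & A `<=` N]]) N.

(* pi : F -> G identifies the topological group G with the quotient F / N. *)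
Definition topological_quotient (F G : topGroupType) (N : set F) (pi : F -> G) :
    Prop :=
  [/\ {morph pi : a b / a * b}, range pi = [set: G],
      [set a | pi a = 1] = N & forall U : set G, open U <-> open (pi @^-1` U)].

(* x_1^3 [x_1, x_2] [x_3, x_4] ... [x_(d-1), x_d] for even d, where the list
   [:: x_1; ...; x_d] is indexed from 0; in the library,
   [~ a, b] = a^-1 * b^-1 * a * b. *)
Definition relator (d : nat) (G : groupType) (x : 'I_d -> G) : G :=
  let xs := [seq x i | i : 'I_d] in
  xs`_0 ^+ 3 * \prod_(i < d./2) [~ xs`_i.*2, xs`_i.*2.+1].

End ProPGroups.

Definition A3_formal_group (p : nat) (G : topGroupType) : Prop :=
  A3_formal (cochains G 'F_p).

Definition gamma (G : topGroupType) : HH (cohomology (cochains G 'F_3)) 3 (-1) :=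
  canonical_class (cochains G 'F_3).

(* Main.v *)
From HB Require Import structures.
Require Import Defs.
From mathcomp Require Import all_boot all_order all_algebra ring.
From mathcomp Require Import generic_quotient ring_quotient.
From mathcomp Require Import all_classical topology.
Set Implicit Arguments.
Unset Strict Implicit.
Unset Printing Implicit Defensive.
Import GRing.Theory.
Local Open Scope classical_set_scope.
Local Open Scope ring_scope.
Local Open Scope quotient_scope.

(** The group [G] carries a character [chi : G -> F_3] taking the value 1 on
    every generator: the relator lies in the kernel of the corresponding
    homomorphism on the free pro-3 group, because cubes and commutators die in
    Z/3 ([exists_character]).  Let [X] in [H^1] be its class.  Everything rests
    on the Massey product <X, X, X>, which is the Bockstein of [X] up to sign
    and does not vanish because of the factor [x_1 ^ 3] of the relator.

    The non-vanishing is proved by hand ([massey_obstruction]).  If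
    [dgad b = - chi chi] and [dgad c = - (chi b + b chi)], then
    [g |-> 1 + chi(g) N + b(g) N^2 + c(g) N^3] is a homomorphism from [G] to the
    commutative group of units congruent to 1 in [F_3[N] / N^4].  It kills the
    commutators of the relator and sends [x_1 ^ 3] to [1 + chi(x_1)^3 N^3],
    whence [chi(x_1) = 0], a contradiction.

    For the canonical class, [m_3(X, X, X)] is the class of
    [- (chi b + b chi)] with [b = f_2(X, X)], so it is non-zero.  On the other
    hand every Hochschild coboundary of degree -1 vanishes on [(X, X, X)]: since
    [X X = 0], its value is [- (X y + y X)] with [y = g(X, X)] in [H^1], where
    [g] is the bounding cochain, and [H] is graded-commutative in degree 1
    ([hdiff_cube], [coh1_anticomm]).

    For formality, an [A_3]-morphism [f_1, f_2, f_3] with [f_1 (x) = chi] yields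
    the forbidden cochains [b = f_2 (x, x)] and [c = - f_3 (x, x, x)]
    ([massey_of_A3_formal]).

    The first argument also needs the canonical class to be represented by some
    [m_3], i.e. that choices of [f_1] and [f_2] exist and that the resulting
    [m_3] is a Hochschild cocycle ([canonical_classP]).  Linear choices come
    from graded complements of the coboundaries in the cocycles and of the
    cocycles in the whole algebra ([graded_complement], by Zorn's lemma); the
    cocycle condition is the boundary computation [m3_pentagon]. *)

(** * Graded algebras *)

Section Graded.
Variables (F : fieldType) (A : gradedAlgType F).
Implicit Types x y : A.

(** Induction for statements that are additive in a graded variable. *)
Lemma graded_ind (P : A -> Prop) :
  (forall x y, P x -> P y -> P (x + y)) ->
  (forall n x, hcomp n x = x -> P x) -> forall x, P x.
Proof.
move=> PD Ph x; have [N ->] := hcomp_sum x; apply: big_ind => //.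
  by apply: (Ph 0%N); rewrite linear0.
by move=> i _; apply: (Ph i); rewrite hcomp_hcomp eqxx.
Qed.

Lemma hcomp_bounded x : exists N, forall i, (N <= i)%N -> hcomp i x = 0.
Proof.
have [N xE] := hcomp_sum x; exists N => i Ni.
rewrite xE linear_sum big1 // => j _; rewrite /= hcomp_hcomp.
by case: eqP => // ij; move: Ni; rewrite ij leqNgt ltn_ord.
Qed.

(** The sum over all degrees that defines [koszul] is a finite sum. *)
Lemma koszulE s x N : (forall i, (N <= i)%N -> hcomp i x = 0) ->
  koszul s x = \sum_(i < N) (-1 : F) ^ (s * i%:Z) *: hcomp i x.
Proof.
move=> x0.
rewrite /koszul (fsbig_ord _ _ (fun i => (-1 : F) ^ (s * i%:Z) *: hcomp i x)).
apply/esym/fsbig_widen => // i [_ /= /negP]; rewrite -leqNgt => /x0 ->.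
exact: scaler0.
Qed.

Fact koszul_linear_subproof s : linear (koszul s : A -> A).
Proof.
move=> k x y; have [N xN] := hcomp_bounded x; have [M yM] := hcomp_bounded y.
have xm i : (maxn N M <= i)%N -> hcomp i x = 0 by rewrite geq_max => /andP[/xN].
have ym i : (maxn N M <= i)%N -> hcomp i y = 0 by rewrite geq_max => /andP[_ /yM].
rewrite !(@koszulE _ _ (maxn N M)) //; last first.
  by move=> i im; rewrite linearP /= xm // ym // scaler0 addr0.
rewrite scaler_sumr -big_split /=; apply: eq_bigr => i _.
by rewrite linearP scalerDr !scalerA mulrC.
Qed.
HB.instance Definition _ s :=
  GRing.isLinear.Build F A A *:%R (koszul s) (koszul_linear_subproof s).

Local Notation eps := (koszul (- 1)).

(** The Koszul sign [a |-> (-1)^|a| a] is an involutive automorphism of the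
    algebra; it replaces the signs attached to homogeneous elements. *)
Lemma koszulN1_homog n x : hcomp n x = x -> eps x = (-1) ^+ n *: x.
Proof.
move=> /koszul_homog ->; congr (_ *: _).
by rewrite mulN1r -exprnN -exprVn invrN1.
Qed.

Lemma koszulN1K x : eps (eps x) = x.
Proof.
elim/graded_ind: x => [x y xE yE|n x xn]; first by rewrite !linearD /= xE yE.
rewrite (koszulN1_homog xn) linearZ /= (koszulN1_homog xn) scalerA.
by rewrite -exprMn mulrNN mulr1 expr1n scale1r.
Qed.

Lemma koszulN1M x y : eps (x * y) = eps x * eps y.
Proof.
elim/graded_ind: x => [x x' xE xE'|m x xm].
  by rewrite mulrDl !linearD /= xE xE' mulrDl.
elim/graded_ind: y => [y y' yE yE'|n y yn].
  by rewrite mulrDr !linearD /= yE yE' mulrDr.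
rewrite (koszulN1_homog (@hcomp_mul _ _ m n _ _ xm yn)).
rewrite (koszulN1_homog xm) (koszulN1_homog yn).
by rewrite -scalerAl -scalerAr scalerA exprD.
Qed.

Lemma homogD k x y : homog k x -> homog k y -> homog k (x + y).
Proof. by case: k => n /= hx hy; rewrite ?linearD /= hx hy // addr0. Qed.

Lemma homogM k l x y : homog k x -> homog l y -> homog (k + l) (x * y).
Proof.
case: k => m; case: l => n.
- exact: hcomp_mul.
- by move=> _ /= ->; rewrite mulr0; exact: homog0.
- by move=> /= -> _; rewrite mul0r; exact: homog0.
- by move=> /= -> _; rewrite mul0r.
Qed.

Lemma homog_pred n x : homog (n.+1%:Z - 1) x <-> hcomp n x = x.
Proof. by rewrite intS addrAC subrr add0r. Qed.

(** A linear subspace that contains the homogeneous components of its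
    elements. *)
Definition graded_subspace (S : set A) : Prop :=
  [/\ S 0, forall k x y, S x -> S y -> S (k *: x + y)
    & forall n x, S x -> S (hcomp n x)].

(** A graded complement of [B] in [Z], in arbitrary dimension: a graded subspace
    of [Z] maximal among those that meet [B] trivially. *)
Lemma graded_complement (Z B : set A) :
    graded_subspace Z -> graded_subspace B ->
  exists S, [/\ graded_subspace S, S `<=` Z, forall x, S x -> B x -> x = 0
    & forall z, Z z -> exists2 s, S s & B (z - s)].
Proof.
move=> [Z0 Zl Zh] [B0 Bl Bh].
pose P S := [/\ forall k x y, S x -> S y -> S (k *: x + y),
  forall n x, S x -> S (hcomp n x), S `<=` Z & forall x, S x -> B x -> x = 0].
have [|S [[Sl Sh SZ SB] Smax]] := @Zorn_bigcup _ P.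
  move=> C CP Ctot; split.
  - move=> k x y [X CX Xx] [Y CY Yy].
    have [XY|YX] := Ctot _ _ CX CY.
      exists Y => //; have [Yl _ _ _] := CP _ CY.
      by apply: Yl => //; exact: XY.
    exists X => //; have [Xl _ _ _] := CP _ CX.
    by apply: Xl => //; exact: YX.
  - by move=> n x [X CX Xx]; exists X => //; have [_ Xh _ _] := CP _ CX; exact: Xh.
  - by move=> x [X CX Xx]; have [_ _ XZ _] := CP _ CX; exact: XZ.
  - by move=> x [X CX Xx]; have [_ _ _ XB] := CP _ CX; exact: XB.
(* The empty set satisfies [P], so that [S 0] is a consequence of maximality. *)
have S0 : S 0.
  apply: contrapT => S0; apply: (Smax [set 0]).
    split=> [x Sx|/(_ 0 erefl) //].
    by case: S0; rewrite -(addNr x) -scaleN1r; exact: Sl.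
  split=> [k _ _ -> ->|n _ ->|_ ->|_ ->] //=.
  - by rewrite scaler0 addr0.
  - by rewrite linear0.
pose T z := exists2 s, S s & B (z - s).
have T0 : T 0 by exists 0; rewrite ?subr0.
have BD x y : B x -> B y -> B (x + y) by rewrite -{2}[x]scale1r; exact: Bl.
have SD x y : S x -> S y -> S (x + y) by rewrite -{2}[x]scale1r; exact: Sl.
have SZ' k x : S x -> S (k *: x) by rewrite -[k *: x]addr0 => ?; exact: Sl.
have BZ k x : B x -> B (k *: x) by rewrite -[k *: x]addr0 => ?; exact: Bl.
exists S; split=> // z Zz; have [N ->] := hcomp_sum z.
apply: (big_ind T) => //.
  move=> x y [s Ss Bs] [t St Bt]; exists (s + t); first exact: SD.
  by rewrite opprD addrACA; exact: BD.
move=> i _; set y := hcomp i z.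
have Zy : Z y by exact: Zh.
have yi : hcomp i y = y by rewrite hcomp_hcomp eqxx.
(* Otherwise S + F y would be a larger admissible subspace. *)
apply: contrapT => nTy.
apply: (Smax [set x | exists2 s, S s & exists k, x = s + k *: y]).
  split=> [s Ss /=|]; first by exists s => //; exists 0; rewrite scale0r addr0.
  move=> /(_ y) yS; apply: nTy; exists y; last by rewrite subrr.
  by apply: yS; exists 0 => //; exists 1; rewrite add0r scale1r.
split=> [k _ _ [s Ss [a ->]] [t St [b ->]]|n _ [s Ss [a ->]]
         |_ [s Ss [a ->]]|_ [s Ss [a ->]] Bs].
- exists (k *: s + t); first exact: Sl.
  by exists (k * a + b); rewrite scalerDr addrACA scalerA scalerDl.
- exists (hcomp n s); first exact: Sh.
  exists (if n == i then a else 0); rewrite linearD linearZ /= -{1}yi hcomp_hcomp.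
  by case: eqP => _; rewrite ?yi ?scale0r ?scaler0.
- by rewrite addrC; apply: Zl => //; exact: SZ.
have [a0|a0] := eqVneq a 0.
  by move: Bs; rewrite a0 scale0r addr0; exact: SB.
case: nTy; exists (- a^-1 *: s); first exact: SZ'.
rewrite scaleNr opprK addrC -[y in _ + y](scalerK a0) -scalerDr; exact: BZ.
Qed.

End Graded.

(** * Cohomology of differential graded algebras *)

Section DGACohomology.
Variables (F : fieldType) (A : dgaType F).
Local Notation H := (cohomology A).
Implicit Types z w : A.

Lemma dgadM_koszul z w :
  dgad (z * w) = dgad z * w + koszul (- 1) z * dgad w.
Proof.
elim/graded_ind: z => [x y xE yE|n x xn].
  by rewrite mulrDl !linearD /= xE yE !mulrDl addrACA.
by rewrite (@dgadM _ _ n _ _ xn) (koszulN1_homog xn) scalerAl.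
Qed.

Lemma coh_classE z (zc : z \in @cocycle F A) :
  coh_class z = \pi_H (Cocycle zc).
Proof.
by congr (\pi_H _); apply: val_inj; rewrite /insubd insubT.
Qed.

Lemma cocycleE z : (z \in @cocycle F A) = (dgad z == 0).
Proof. by []. Qed.

Lemma coh_class_eq0 z : dgad z = 0 ->
  coh_class z = 0 <-> exists t, z = dgad t.
Proof.
move=> /eqP zc; rewrite (coh_classE zc) -(raddf0 \pi_H) cohomology_eq /=.
by rewrite subr0.
Qed.

Lemma coh_class_linear k z w : dgad z = 0 -> dgad w = 0 ->
  coh_class (k *: z + w) = k *: coh_class z + coh_class w.
Proof.
move=> /eqP z0 /eqP w0.
have kzw0 : k *: z + w \in @cocycle F A.
  by rewrite cocycleE linearP /= (eqP z0) (eqP w0) scaler0 addr0.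
rewrite (coh_classE kzw0) (coh_classE z0) (coh_classE w0).
transitivity (\pi_H (k *: Cocycle z0 + Cocycle w0)).
  by congr (\pi_H _); exact: val_inj.
by rewrite (Defs.pi_add (k *: Cocycle z0) (Cocycle w0)) -(pi_scale k (Cocycle z0)).
Qed.

Lemma coh_class0 : coh_class (0 : A) = 0.
Proof.
have d0 : dgad (0 : A) = 0 by exact: linear0.
by apply: (coh_class_eq0 d0).2; exists 0.
Qed.

Lemma coh_classD z w : dgad z = 0 -> dgad w = 0 ->
  coh_class (z + w) = coh_class z + coh_class w.
Proof.
by move=> z0 w0; rewrite -{1}[z]scale1r coh_class_linear // scale1r.
Qed.

Lemma coh_classZ k z : dgad z = 0 -> coh_class (k *: z) = k *: coh_class z.
Proof.
by move=> z0; rewrite -[k *: z]addr0 coh_class_linear ?linear0 // coh_class0 addr0.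
Qed.

Lemma coh_classN z : dgad z = 0 -> coh_class (- z) = - coh_class z.
Proof. by move=> z0; rewrite -scaleN1r coh_classZ // scaleN1r. Qed.

Lemma coh_classB z w : dgad z = 0 -> dgad w = 0 ->
  coh_class (z - w) = coh_class z - coh_class w.
Proof.
by move=> z0 w0; rewrite coh_classD ?coh_classN // linearN /= w0 oppr0.
Qed.

Lemma coh_classM z w : dgad z = 0 -> dgad w = 0 ->
  coh_class (z * w) = coh_class z * coh_class w.
Proof.
move=> /eqP z0 /eqP w0.
have zw0 : z * w \in @cocycle F A by rewrite cocycleE dgadMl ?(eqP z0) ?(eqP w0).
rewrite (coh_classE zw0) (coh_classE z0) (coh_classE w0).
rewrite -[RHS]/(coh_mul _ _) (Defs.pi_mul (Cocycle z0) (Cocycle w0)).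
congr (\pi_H _); exact: val_inj.
Qed.

Lemma coh_class_hcomp n z : dgad z = 0 ->
  hcomp n (coh_class z) = coh_class (hcomp n z).
Proof.
move=> /eqP z0.
have hz0 : hcomp n z \in @cocycle F A := cocycle_hcomp n (Cocycle z0).
rewrite (coh_classE z0) (coh_classE hz0) -[LHS]/(coh_hcomp n _).
rewrite (pi_hcomp n (Cocycle z0)).
by congr (\pi_H _); apply: val_inj.
Qed.

Lemma homog_coh_class k z : dgad z = 0 -> homog k z -> homog k (coh_class z).
Proof.
by case: k => n /= z0 zn; rewrite ?coh_class_hcomp // zn // coh_class0.
Qed.

Lemma coh_class_surj (h : H) : exists2 z : A, dgad z = 0 & coh_class z = h.
Proof.
elim/quotW: h => z; exists (val z); first exact/eqP/(valP z).
rewrite (coh_classE (valP z)); congr (\pi_H _); exact: val_inj.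
Qed.

(** In degree 1 the only coboundary is 0, since the algebra is connected. *)
Lemma coh_class_inj1 z w : hcomp 1 z = z -> hcomp 1 w = w ->
  dgad z = 0 -> dgad w = 0 -> coh_class z = coh_class w -> z = w.
Proof.
move=> z1 w1 z0 w0 /eqP; rewrite -subr_eq0 -coh_classB // => /eqP.
have zw0 : dgad (z - w) = 0 by rewrite linearB /= z0 w0 subrr.
case/(coh_class_eq0 zw0) => t tE.
apply/eqP; rewrite -subr_eq0 -[z]z1 -[w]w1 -linearB.
have [c cE] := hcomp0_scalar t.
by rewrite tE /= hcompS_dgad cE linearZ /= dgad1 scaler0.
Qed.

Lemma ker_dgad_graded : graded_subspace [set z : A | dgad z = 0].
Proof.
split=> /= [|k x y x0 y0|n x x0]; first exact: linear0.
  by rewrite linearP /= x0 y0 scaler0 addr0.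
by rewrite -hcompS_dgad x0 linear0.
Qed.

Lemma im_dgad_graded : graded_subspace [set z : A | exists t, z = dgad t].
Proof.
split=> /= [|k _ _ [x ->] [y ->]|[|n] _ [x ->]].
- by exists 0; rewrite linear0.
- by exists (k *: x + y); rewrite linearP.
- by exists 0; rewrite hcomp0_dgad linear0.
- by exists (hcomp n x); rewrite hcompS_dgad.
Qed.

(** A graded linear section of the projection from cocycles to cohomology. *)
Lemma cocycle_section : exists f : H -> A, [/\ linear f,
  forall n x, hcomp n x = x -> hcomp n (f x) = f x,
  forall x, dgad (f x) = 0 & forall x, coh_class (f x) = x].
Proof.
have [S [[S0 Sl Sh] SZ SB ZS]] :=
  graded_complement ker_dgad_graded im_dgad_graded.
have Sinj (s t : A) : S s -> S t -> coh_class s = coh_class t -> s = t.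
  move=> Ss St /eqP; have [s0 t0] := (SZ _ Ss, SZ _ St).
  rewrite -subr_eq0 -coh_classB // => /eqP /coh_class_eq0 st.
  apply/eqP; rewrite -subr_eq0; apply/eqP/SB.
    by rewrite -addrC -scaleN1r; exact: Sl.
  by apply: st; rewrite linearB /= s0 t0 subrr.
have sec x : exists s, S s /\ coh_class s = x.
  have [z z0 <-] := coh_class_surj x; have [s Ss /= [t tE]] := ZS _ z0.
  have s0 := SZ _ Ss; exists s; split=> //; apply/eqP.
  rewrite eq_sym -subr_eq0 -coh_classB //; apply/eqP/coh_class_eq0; last by exists t.
  by rewrite linearB /= z0 s0 subrr.
pose f x := projT1 (cid (sec x)).
have fS x : S (f x) by rewrite /f; case: cid => ? [].
have fK x : coh_class (f x) = x by rewrite /f; case: cid => ? [].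
have f0 x : dgad (f x) = 0 by apply: SZ.
exists f; split=> // [k x y|n x xn]; apply: Sinj => //.
- exact: Sl.
- by rewrite coh_class_linear // !fK.
- exact: Sh.
- by rewrite -coh_class_hcomp // !fK.
Qed.

(** A graded section of the differential, linear on the coboundaries. *)
Lemma dgad_section : exists h : A -> A, [/\
  forall k t u, h (k *: dgad t + dgad u) = k *: h (dgad t) + h (dgad u),
  forall n t, hcomp n.+1 (dgad t) = dgad t -> hcomp n (h (dgad t)) = h (dgad t)
  & forall t, dgad (h (dgad t)) = dgad t].
Proof.
have ZT : graded_subspace [set: A] by [].
have [S [[S0 Sl Sh] _ SB ZS]] := graded_complement ZT ker_dgad_graded.
have Sinj s t : S s -> S t -> dgad s = dgad t -> s = t.
  move=> Ss St st; apply/eqP; rewrite -subr_eq0; apply/eqP/SB.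
    by rewrite -addrC -scaleN1r; exact: Sl.
  by rewrite /= linearB /= st subrr.
have sec y : exists s, S s /\ ((exists t, y = dgad t) -> dgad s = y).
  have [[t ->]|n] := pselect (exists t, y = dgad t); last by exists 0.
  have [s Ss /= ts] := ZS t I; exists s; split=> // _.
  by apply/eqP; rewrite eq_sym -subr_eq0 -linearB /= ts.
pose h y := projT1 (cid (sec y)).
have hS y : S (h y) by rewrite /h; case: cid => ? [].
have hK t : dgad (h (dgad t)) = dgad t.
  by rewrite /h; case: cid => ? [_] /= -> //; exists t.
exists h; split=> // [k t u|n t tn]; apply: Sinj => //.
- exact: Sl.
- by rewrite linearP /= !hK -linearP hK.
- exact: Sh.
- by rewrite -hcompS_dgad hK.
Qed.

End DGACohomology.

(** * Existence of the canonical class *)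

Lemma size_contract_op (T : Type) (op : T -> T -> T) i l :
  (i.+1 < size l)%N -> size (contract op i l) = (size l).-1.
Proof.
elim: i l => [|i IH] [|a [|b l]] //= il; rewrite ?contract0 ?contractS //=.
by rewrite IH.
Qed.

Section CanonicalClass.
Variables (F : fieldType) (A : dgaType F).
Local Notation H := (cohomology A).
Local Notation eps := (koszul (- 1)).

(** [f] is a graded linear choice of cocycles and [h] a graded section of the
    differential on the coboundaries. *)
Section Choice.
Variables (f : H -> A) (h : A -> A).
Hypothesis f_lin : linear f.
Hypothesis f_hcomp : forall n x, hcomp n x = x -> hcomp n (f x) = f x.
Hypothesis f_cocycle : forall x, dgad (f x) = 0.
Hypothesis fK : forall x, coh_class (f x) = x.
Hypothesis h_lin : forall k t u,
  h (k *: dgad t + dgad u) = k *: h (dgad t) + h (dgad u).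
Hypothesis h_hcomp : forall n t,
  hcomp n.+1 (dgad t) = dgad t -> hcomp n (h (dgad t)) = h (dgad t).
Hypothesis hK : forall t, dgad (h (dgad t)) = dgad t.
Implicit Types x y z w : H.

HB.instance Definition _ := GRing.isLinear.Build F H A *:%R f f_lin.

(** The failure of [f] to be multiplicative, a coboundary, and the bilinear map
    that trivializes it. *)
Definition defect x y : A := f (x * y) - f x * f y.
Definition f2 x y : A := h (defect x y).

Lemma defect_dgad x y : exists t, defect x y = dgad t.
Proof.
have d0 : dgad (f x * f y) = 0 by rewrite dgadMl.
apply/coh_class_eq0; first by rewrite linearB /= f_cocycle d0 subrr.
by rewrite coh_classB // coh_classM // !fK subrr.
Qed.

Lemma dgad_f2 x y : dgad (f2 x y) = f (x * y) - f x * f y.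
Proof. by rewrite /f2; have [t tE] := defect_dgad x y; rewrite tE hK -tE. Qed.

Lemma f2_linl y : linear (f2^~ y).
Proof.
move=> k x x'; rewrite /f2.
have -> : defect (k *: x + x') y = k *: defect x y + defect x' y.
  rewrite /defect mulrDl -scalerAl !linearP /= mulrDl -scalerAl.
  by rewrite scalerBr opprD addrACA.
by have [t ->] := defect_dgad x y; have [u ->] := defect_dgad x' y.
Qed.

Lemma f2_linr x : linear (f2 x).
Proof.
move=> k y y'; rewrite /f2.
have -> : defect x (k *: y + y') = k *: defect x y + defect x y'.
  rewrite /defect mulrDr -scalerAr !linearP /= mulrDr -scalerAr.
  by rewrite scalerBr opprD addrACA.
by have [t ->] := defect_dgad x y; have [u ->] := defect_dgad x y'.
Qed.

Lemma f2_homog (i j : nat) x y : hcomp i x = x -> hcomp j y = y ->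
  homog ((i + j)%N%:Z - 1) (f2 x y).
Proof.
move=> xi yj.
have dij : hcomp (i + j)%N (defect x y) = defect x y.
  rewrite /defect linearB /= f_hcomp; last exact: hcomp_mul.
  by rewrite (@hcomp_mul _ _ i j) // f_hcomp.
rewrite /f2; have [t tE] := defect_dgad x y; rewrite tE in dij *.
case: (i + j)%N dij => [|n] tn; last by apply/homog_pred; exact: h_hcomp.
have h0 : h 0 = 0.
  by have := h_lin (-1) 0 0; rewrite linear0 scaler0 addr0 scaleN1r addNr.
by rewrite -tn hcomp0_dgad h0; exact: homog0.
Qed.

Lemma f_eps x : f (eps x) = eps (f x).
Proof.
elim/graded_ind: x => [x y xE yE|n x xn]; first by rewrite !linearD /= xE yE.
by rewrite (koszulN1_homog xn) linearZ (koszulN1_homog (f_hcomp xn)).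
Qed.

Lemma f2_eps x y : f2 (eps x) (eps y) = - eps (f2 x y).
Proof.
elim/graded_ind: x => [x x' xE xE'|m x xm].
  have D a b c : f2 (a + b) c = f2 a c + f2 b c.
    exact: (GRing.semilinear_linear (f2_linl c)).2.
  by rewrite linearD /= !D xE xE' !linearD.
elim/graded_ind: y => [y y' yE yE'|n y yn].
  have D a b c : f2 a (b + c) = f2 a b + f2 a c.
    exact: (GRing.semilinear_linear (f2_linr a)).2.
  by rewrite linearD /= !D yE yE' !linearD.
rewrite (koszulN1_homog xm) (koszulN1_homog yn).
have Zl k a b : f2 (k *: a) b = k *: f2 a b.
  exact: (GRing.scalable_linear (f2_linl b)).
have Zr k a b : f2 a (k *: b) = k *: f2 a b.
  exact: (GRing.scalable_linear (f2_linr a)).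
rewrite Zl Zr scalerA -exprD.
case: (m + n)%N (f2_homog xm yn) => [/= ->|p /homog_pred/koszulN1_homog ->].
  by rewrite scaler0 linear0 oppr0.
by rewrite exprS mulN1r scaleNr.
Qed.

(** The cocycles that represent [m_3], for arguments not necessarily
    homogeneous: the sign [(-1)^|x|] is applied to [x] through [koszul]. *)
Definition Phi x y z : A :=
  f (eps x) * f2 y z - f2 x y * f z - f2 (x * y) z + f2 x (y * z).

Lemma Phi_cocycle x y z : dgad (Phi x y z) = 0.
Proof.
rewrite /Phi !linearD !linearN /= !dgadM_koszul !dgad_f2 !f_cocycle.
rewrite mul0r mulr0 add0r addr0 f_eps koszulN1K !mulrBl !mulrBr !mulrA.
rewrite !opprB !addrA.
by rewrite !subrK subrr.
Qed.

Definition m3 (l : seq H) : H :=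
  if l is [:: x; y; z] then coh_class (Phi x y z) else 0.

(** The Hochschild coboundary of [m_3] is zero, at the level of cocycles: after
    cancellation of sixteen terms only
    [(f(eps a) f(eps b) - f(eps a eps b)) f2(c, e)
     + f2(a, b) (f(c e) - f(c) f(e))]
    is left, which bounds by the Leibniz rule. *)
Lemma m3_pentagon a b c e :
  f (eps a) * Phi b c e - Phi (a * b) c e + Phi a (b * c) e - Phi a b (c * e)
    + Phi a b c * f e = dgad (- (f2 (eps a) (eps b) * f2 c e)).
Proof.
rewrite linearN /= dgadM_koszul !dgad_f2.
have -> : koszul (-1) (f2 (eps a) (eps b)) = - f2 a b.
  by rewrite f2_eps linearN /= koszulN1K.
rewrite /Phi koszulN1M mulNr opprB.
rewrite !(mulrDr, mulrDl, mulrN, mulNr) !mulrA !(opprD, opprK) !addrA.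
(* The first four terms survive; the others are paired with their opposites. *)
rewrite [LHS](ACl ((14*18*5*1)*(2*17)*(3*9)*(4*13)*(6*19)*(7*11)*(8*15)
                   *(10*20)*(12*16)))/=.
by rewrite !(addNr, subrr, addr0).
Qed.

Lemma Phi_homog (i j k : nat) x y z :
    hcomp i x = x -> hcomp j y = y -> hcomp k z = z ->
  homog ((i + j + k)%N%:Z - 1) (Phi x y z).
Proof.
move=> xi yj zk.
have H1 (n : nat) u : hcomp n u = u -> homog n (f u) by exact: f_hcomp.
have xi' : hcomp i (eps x) = eps x.
  by rewrite (koszulN1_homog xi) linearZ /= xi.
have h1 : homog ((i + j + k)%N%:Z - 1) (f (eps x) * f2 y z).
  rewrite -addnA PoszD -addrA; apply: homogM; [exact: H1|exact: f2_homog].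
have h2 : homog ((i + j + k)%N%:Z - 1) (f2 x y * f z).
  by rewrite PoszD addrAC; apply: homogM; [exact: f2_homog|exact: H1].
have h3 : homog ((i + j + k)%N%:Z - 1) (f2 (x * y) z).
  by apply: f2_homog => //; exact: (@hcomp_mul _ _ i j).
have h4 : homog ((i + j + k)%N%:Z - 1) (f2 x (y * z)).
  by rewrite -addnA; apply: f2_homog => //; exact: (@hcomp_mul _ _ j k).
by apply: homogD => //; apply: homogB => //; apply: homogB.
Qed.

Let lin4 k (p q r s p' q' r' s' : A) :
  (k *: p + p') - (k *: q + q') - (k *: r + r') + (k *: s + s')
  = k *: (p - q - r + s) + (p' - q' - r' + s').
Proof.
rewrite !scalerDr !scalerN !opprD !addrA.
by rewrite [LHS](ACl ((1*3*5*7)*2*4*6*8)).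
Qed.

Lemma Phi_linl y z k x x' : Phi (k *: x + x') y z = k *: Phi x y z + Phi x' y z.
Proof.
rewrite /Phi mulrDl -scalerAl !linearP (f2_linl y) (f2_linl z) (f2_linl (y * z)).
by rewrite !mulrDl -!scalerAl lin4.
Qed.

Lemma Phi_linm x z k y y' : Phi x (k *: y + y') z = k *: Phi x y z + Phi x y' z.
Proof.
rewrite /Phi mulrDr mulrDl -scalerAl -scalerAr (f2_linl z) (f2_linr x).
rewrite (f2_linl z) (f2_linr x) mulrDr mulrDl -scalerAl -scalerAr.
exact: lin4.
Qed.

Lemma Phi_linr x y k z z' : Phi x y (k *: z + z') = k *: Phi x y z + Phi x y z'.
Proof.
rewrite /Phi mulrDr -scalerAr !linearP (f2_linr y) (f2_linr (x * y)) (f2_linr x).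
by rewrite !mulrDr -!scalerAr lin4.
Qed.

Lemma m3_graded_map : graded_map 3 (-1) m3.
Proof.
split.
- by move=> [|? [|? [|? [|? ?]]]].
- move=> [|? [|? [|? ?]]] [|? [|? [|? ?]]] //= _ k x y /=.
  + by rewrite Phi_linl coh_class_linear // Phi_cocycle.
  + by rewrite Phi_linm coh_class_linear // Phi_cocycle.
  + by rewrite Phi_linr coh_class_linear // Phi_cocycle.
move=> k [|x [|y [|z []]]] //= _ kE.
apply: homog_coh_class; first exact: Phi_cocycle.
rewrite !big_ord_recr big_ord0 /= add0n.
by apply: Phi_homog; [exact: (kE 0%N)|exact: (kE 1%N)|exact: (kE 2%N)].
Qed.

Lemma hdiff_m3 : hdiff (-1) m3 = 0.
Proof.
apply/funext => -[//|a t]; rewrite -[RHS]/(0 : H) /hdiff.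
(* On lists whose length is not 4, every term is a value of [m3] on a list
   whose length is not 3. *)
have [/eqP t3|/eqP t3] := eqVneq (size t) 3; last first.
  have z l : size l <> 3%N -> m3 l = 0 by case: l => [|? [|? [|? [|? ?]]]].
  rewrite z // mulr0 add0r big1 => [|i _]; last first.
    by rewrite z ?scaler0 // size_contract_op //= ltnS.
  by rewrite z ?mul0r ?scaler0 ?addr0 // size_takel.
case: t t3 => [|b [|c [|e []]]] //= _.
rewrite !big_ord_recl big_ord0 /=.
have D0 (u v : A) : dgad u = 0 -> dgad v = 0 -> dgad (u + v) = 0.
  by move=> u0 v0; rewrite linearD /= u0 v0 addr0.
have N0 (u : A) : dgad u = 0 -> dgad (- u) = 0.
  by move=> u0; rewrite linearN /= u0 oppr0.
have TE := m3_pentagon a b c e.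
have T0 := congr1 (@dgad F A) TE; rewrite dgadK in T0.
have /(coh_class_eq0 T0).2 : exists t, f (eps a) * Phi b c e - Phi (a * b) c e
    + Phi a (b * c) e - Phi a b (c * e) + Phi a b c * f e = dgad t.
  by eexists; exact: TE.
move: (Phi_cocycle b c e) (Phi_cocycle (a * b) c e) (Phi_cocycle a (b * c) e).
move: (Phi_cocycle a b (c * e)) (Phi_cocycle a b c).
move: (Phi b c e) (Phi (a * b) c e) (Phi a (b * c) e) (Phi a b (c * e)) (Phi a b c).
move=> p q r s t t0 s0 p0 q0 r0.
have fp0 : dgad (f (eps a) * p) = 0 by exact: dgadMl.
have tf0 : dgad (t * f e) = 0 by exact: dgadMl.
have B0 (u v : A) : dgad u = 0 -> dgad v = 0 -> dgad (u - v) = 0.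
  by move=> u0 v0; apply: (D0) => //; exact: N0.
rewrite coh_classD; [|by do ?[apply: (B0)|apply: (D0)]|by []].
rewrite coh_classB; [|by do ?[apply: (B0)|apply: (D0)]|by []].
rewrite coh_classD; [|exact: B0|by []].
rewrite coh_classB // !coh_classM // !fK => sum0.
rewrite /bump /= !exprS expr0 !(mulN1r, mulr1, opprK, scaleN1r, scale1r).
by rewrite addr0 !addrA.
Qed.

Lemma m3_hcocycle : m3 \in hcocycle 3 (-1).
Proof. by apply/asboolP; split; [exact: m3_graded_map|exact: hdiff_m3]. Qed.

(** [f] and [f2] as graded maps on lists. *)
Definition choice1 (l : seq H) : A := if l is [:: x] then f x else 0.
Definition choice2 (l : seq H) : A := if l is [:: x; y] then f2 x y else 0.

Lemma canonical_choiceP : canonical_choice choice1 choice2.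
Proof.
split=> //; last exact: dgad_f2.
  split; first by move=> [|? []].
    by move=> [|? ?] [|? ?] //= _ k x y; rewrite linearP.
  move=> k [|x []] //= _ kE; rewrite big_ord1 addn0; apply: f_hcomp.
  exact: (kE 0%N).
split; first by move=> [|? [|? []]].
  by move=> [|a [|? ?]] [|b [|? ?]] //= _ k x y; [exact: f2_linl|exact: f2_linr].
move=> k [|x [|y []]] //= _ kE; rewrite !big_ord_recr big_ord0 /= add0n.
by apply: f2_homog; [exact: (kE 0%N)|exact: (kE 1%N)].
Qed.

Lemma canonical_repP : canonical_rep choice1 choice2 (HCocycle m3_hcocycle).
Proof.
move=> i j k x y z xi _ _; congr coh_class; rewrite /Phi /Phi3 /=.
by rewrite (koszulN1_homog xi) linearZ -scalerAl.
Qed.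

End Choice.

(** The canonical class is the class of the [m_3] attached to some choices, as
    opposed to the default value of its definition. *)
Lemma canonical_classP : exists f1 f2 m3, [/\ canonical_choice f1 f2,
  canonical_rep f1 f2 m3 & canonical_class A = HH_class m3].
Proof.
have [f [f_lin f_hcomp f_cocycle fK]] := cocycle_section A.
have [h [h_lin h_hcomp hK]] := dgad_section A.
rewrite /canonical_class; case: xgetP => [_ -> [f1 [f2' [m [ch rep ->]]]]|].
  by exists f1, f2', m.
move=> /(_ (HH_class (HCocycle
  (m3_hcocycle f_lin f_hcomp f_cocycle fK h_lin h_hcomp hK)))) [].
do 3 eexists; split; [|exact: canonical_repP|by []].
exact: canonical_choiceP.
Qed.
End CanonicalClass.

(** * Consequences of triviality of the canonical class and of formality *)

Section Obstruction.
Variable F : fieldType.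

Lemma linear_fun0 (U V : lmodType F) (g : U -> V) : linear g -> g 0 = 0.
Proof. by move=> gl; rewrite -(addNr 0) -scaleN1r gl scaleN1r addNr. Qed.

Lemma graded_map2_0l (A B : gradedAlgType F) s (g : seq A -> B) y :
  graded_map 2 s g -> g [:: 0; y] = 0.
Proof. by move=> [_ /(_ [::] [:: y] erefl) /linear_fun0]. Qed.

Lemma graded_map2_0r (A B : gradedAlgType F) s (g : seq A -> B) y :
  graded_map 2 s g -> g [:: y; 0] = 0.
Proof. by move=> [_ /(_ [:: y] [::] erefl) /linear_fun0]. Qed.

Lemma graded_map1_hcomp (A B : gradedAlgType F) (g : seq A -> B) n x :
  graded_map 1 0 g -> hcomp n x = x -> hcomp n (g [:: x]) = g [:: x].
Proof.
move=> [_ _ gh] xn; have := gh (fun=> n) [:: x] erefl.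
by rewrite big_ord1 addr0; apply => -[].
Qed.

Lemma graded_map2_hcomp1 (A B : gradedAlgType F) (g : seq A -> B) x y :
  graded_map 2 (-1) g -> hcomp 1 x = x -> hcomp 1 y = y ->
  hcomp 1 (g [:: x; y]) = g [:: x; y].
Proof.
move=> [_ _ gh] x1 y1; have := gh (fun=> 1%N) [:: x; y] erefl.
by rewrite !big_ord_recr big_ord0 /=; apply => -[|[]].
Qed.

(** Hochschild coboundaries of degree -1 vanish on [(x, x, x)] if [x] has degree
    1, square zero, and anticommutes with degree 1. *)
Lemma hdiff_cube (A : gradedAlgType F) (x : A) (g : seq A -> A) :
  hcomp 1 x = x -> (forall y, hcomp 1 y = y -> x * y + y * x = 0) ->
  x * x = 0 -> graded_map 2 (-1) g -> hdiff (-1) g [:: x; x; x] = 0.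
Proof.
move=> x1 x_ac xx0 gm; rewrite /hdiff !big_ord_recl big_ord0 /=.
rewrite /bump /= contractS !contract0 xx0.
rewrite (graded_map2_0l _ gm) (graded_map2_0r _ gm) !scaler0 !addr0.
rewrite (koszulN1_homog x1) !exprS expr0 !(mulN1r, mulr1, opprK, scaleN1r).
by rewrite mulNr -opprD x_ac ?oppr0 //; exact: graded_map2_hcomp1.
Qed.

Section DGA.
Variable A : dgaType F.
Local Notation H := (cohomology A).

(** If [x] has degree 1 and square zero and [m_3 (x, x, x) = 0], then the Massey
    product <x, x, x> contains 0. *)
Lemma massey_of_Phi3 (f1 f2 : seq H -> A) (x : H) :
    canonical_choice f1 f2 -> hcomp 1 x = x -> x * x = 0 ->
    coh_class (Phi3 f1 f2 1 x x x) = 0 ->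
  exists b c, [/\ hcomp 1 b = b, hcomp 1 c = c,
    dgad b = - (f1 [:: x] * f1 [:: x]) &
    dgad c = - (f1 [:: x] * b + b * f1 [:: x])].
Proof.
move=> [gm1 gm2 f1c _ f2E] x1 xx0.
have f10 : f1 [:: 0] = 0.
  by case: gm1 => _ /(_ [::] [::] erefl) /linear_fun0.
set a := f1 [:: x]; set b := f2 [:: x; x].
have a1 : hcomp 1 a = a := graded_map1_hcomp gm1 x1.
have b1 : hcomp 1 b = b := graded_map2_hcomp1 gm2 x1 x1.
have a0 : dgad a = 0 := f1c x.
have bE : dgad b = - (a * a) by rewrite f2E xx0 f10 sub0r.
have -> : Phi3 f1 f2 1 x x x = - (a * b + b * a).
  rewrite /Phi3 xx0 (graded_map2_0l _ gm2) (graded_map2_0r _ gm2) subr0 addr0.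
  by rewrite expr1 scaleN1r opprD.
have ab0 : dgad (- (a * b + b * a)) = 0.
  rewrite linearN linearD /= (@dgadM _ _ 1 a) // (@dgadM _ _ 1 b) // a0 bE.
  rewrite mul0r mulr0 scaler0 add0r addr0 expr1 scaleN1r mulrN mulNr opprK.
  by rewrite mulrA subrr oppr0.
(* [t] need not be homogeneous, but its component of degree 1 has the same
   boundary. *)
case/(coh_class_eq0 ab0) => t tE; exists b, (hcomp 1 t); split=> //.
  by rewrite hcomp_hcomp.
rewrite -hcompS_dgad -tE linearN linearD /= (@hcomp_mul _ _ 1 1 a b) //.
by rewrite (@hcomp_mul _ _ 1 1 b a).
Qed.

(** In an [A_3]-formal algebra, <x, x, x> contains 0 for every [x] of degree 1
    and square zero. *)
Lemma massey_of_A3_formal (f1 f2 f3 : seq H -> A) (x : H) :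
    graded_map 1 0 f1 -> graded_map 2 (-1) f2 -> graded_map 3 (-2) f3 ->
    A3_eq2 f1 f2 -> hcomp 1 x = x -> x * x = 0 ->
    dgad (f3 [:: x; x; x]) + (-1) ^+ 1 *: (f1 [:: x] * f2 [:: x; x])
      - f2 [:: x; x] * f1 [:: x] = f2 [:: x * x; x] - f2 [:: x; x * x] ->
  exists b c, [/\ hcomp 1 b = b, hcomp 1 c = c,
    dgad b = - (f1 [:: x] * f1 [:: x]) &
    dgad c = - (f1 [:: x] * b + b * f1 [:: x])].
Proof.
move=> gm1 gm2 gm3 f2E x1 xx0 f3E.
have f10 : f1 [:: 0] = 0.
  by case: gm1 => _ /(_ [::] [::] erefl) /linear_fun0.
exists (f2 [:: x; x]), (- f3 [:: x; x; x]); split.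
- exact: graded_map2_hcomp1.
- case: gm3 => _ _ /(_ (fun=> 1%N) [:: x; x; x] erefl).
  rewrite !big_ord_recr big_ord0 linearN => gh; congr (- _); apply: gh.
  by case=> [|[|[]]].
- by rewrite f2E xx0 f10 sub0r.
move: f3E; rewrite xx0 (graded_map2_0l _ gm2) (graded_map2_0r _ gm2) subrr.
rewrite expr1 scaleN1r -addrA -opprD => /eqP; rewrite subr_eq0 => /eqP <-.
exact: linearN.
Qed.

(** The map induced by [f1] commutes with the projections to degree [n]. *)
Lemma coh_class_graded_map (f1 : seq H -> A) n x :
  graded_map 1 0 f1 -> (forall y, dgad (f1 [:: y]) = 0) ->
  hcomp n (coh_class (f1 [:: x])) = coh_class (f1 [:: hcomp n x]).
Proof.
move=> gm1 f1c; have [_ /(_ [::] [::] erefl) /= f1l _] := gm1.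
have f1D y z : f1 [:: y + z] = f1 [:: y] + f1 [:: z].
  exact: (GRing.semilinear_linear f1l).2.
elim/graded_ind: x => [x y xE yE|m x xm].
  by rewrite linearD /= !f1D !coh_classD // linearD /= xE yE.
have fm := graded_map1_hcomp gm1 xm.
rewrite coh_class_hcomp // -fm -xm !hcomp_hcomp xm fm.
by case: eqP => // _; rewrite (linear_fun0 f1l).
Qed.
End DGA.
End Obstruction.

Lemma HH_class_eq0 (F : fieldType) (A : gradedAlgType F) n s
    (c : hcocycles A n.+1 s) :
  HH_class c = 0 -> exists2 g, graded_map n s g & val c = hdiff s g.
Proof.
have -> : (HH_class c = 0) <-> (c - 0 \in @hcoboundary F A n.+1 s).
  by rewrite -(raddf0 (\pi_(HH A n.+1 s))) Quotient.idealrBE; split=> /eqP.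
by rewrite subr0 => /asboolP.
Qed.

(** If the Massey product <X, X, X> of a class of degree 1 and square zero that
    anticommutes with all classes of degree 1 does not contain 0, then neither is
    the canonical class trivial nor the algebra [A_3]-formal. *)
Lemma massey_obstructs_formality (F : fieldType) (A : dgaType F) (a : A) :
    hcomp 1 a = a -> dgad a = 0 -> coh_class a * coh_class a = 0 ->
    (forall y, hcomp 1 y = y -> coh_class a * y + y * coh_class a = 0) ->
    (forall b c, hcomp 1 b = b -> hcomp 1 c = c ->
      dgad b = - (a * a) -> dgad c = - (a * b + b * a) -> False) ->
  canonical_class A <> 0 /\ ~ A3_formal A.
Proof.
move=> a1 a0; set X := coh_class a => XX0 X_ac no_massey.
have X1 : hcomp 1 X = X by rewrite /X coh_class_hcomp // a1.
split.
  have [f1 [f2 [m3 [ch rep ->]]]] := canonical_classP A.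
  move=> /HH_class_eq0[g gm m3E].
  have := rep 1%N 1%N 1%N X X X X1 X1 X1; rewrite m3E hdiff_cube //.
  move=> /esym /(massey_of_Phi3 ch X1 XX0)[b [c [b1 c1]]].
  have [gm1 _ f1c f1K _] := ch.
  have -> : f1 [:: X] = a.
    by apply: coh_class_inj1 => //; exact: graded_map1_hcomp.
  exact: no_massey.
move=> [f1 [f2 [f3 [[gm1 gm2 gm3] [f1c f1_bij f2E f3E]]]]].
have [phi phiK Kphi] := f1_bij.
(* The preimage of [X] under the isomorphism induced by [f1] may be replaced by
   its component of degree 1. *)
pose x := hcomp 1 (phi X).
have x1 : hcomp 1 x = x by rewrite hcomp_hcomp.
have xX : coh_class (f1 [:: x]) = X by rewrite -coh_class_graded_map // Kphi X1.
have f1x : f1 [:: x] = a.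
  by apply: coh_class_inj1 => //; exact: graded_map1_hcomp.
have xx0 : x * x = 0.
  apply: (bij_inj f1_bij).
  have [_ /(_ [::] [::] erefl) /linear_fun0 /= -> _] := gm1.
  rewrite -[f1 _](subrK (f1 [:: x] * f1 [:: x])) -f2E.
  rewrite coh_classD ?dgadK ?dgadMl // coh_classM // xX XX0 addr0 coh_class0.
  by apply/coh_class_eq0; [exact: dgadK|eexists].
have [b [c []]] := massey_of_A3_formal gm1 gm2 gm3 f2E x1 xx0
  (f3E 1%N 1%N 1%N _ _ _ x1 x1 x1).
by rewrite f1x; exact: no_massey.
Qed.

(** * Cochains of degree 1 *)

Section LowDegreeCochains.
Variables (G : topGroupType) (K : fieldType).
Implicit Types (a b : cochains G K) (g h : G).

Lemma cochain_deg a n s : hcomp n a = a -> size s <> n -> a s = 0.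
Proof. by move=> /cochain_hcompP; exact. Qed.

Lemma cochain_mul11 a b g h : hcomp 1 a = a -> hcomp 1 b = b ->
  (a * b) [:: g; h] = a [:: g] * b [:: h].
Proof.
move=> a1 b1; rewrite -[LHS]/(cup a b [:: g; h]) !cup_cons cup_nil.
rewrite [a [::]](cochain_deg a1) // [b [::]](cochain_deg b1) //.
by rewrite mul0r mulr0 addr0 add0r.
Qed.

Lemma cochain_dgad1 a g h :
  dgad a [:: g; h] = a [:: h] - a [:: (g * h)%g] + a [:: g].
Proof.
by rewrite -[LHS]/(cdiff a [:: g; h]) cdiff_cons2 cdiff1 subr0.
Qed.

Lemma cocycle1M a g h : hcomp 1 a = a -> dgad a = 0 ->
  a [:: (g * h)%g] = a [:: g] + a [:: h].
Proof.
move=> a1 a0; have := cochain_dgad1 a g h; rewrite a0 -[LHS]/0 => /esym/eqP.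
by rewrite addrAC subr_eq0 => /eqP <-; rewrite addrC.
Qed.

(** The pointwise product, which bounds the anticommutator of two cocycles of
    degree 1 up to sign. *)
Fact cochain_pmul_subproof a b :
  ((fun s => a s * b s) : seq G -> K^o) \in @cochain G K.
Proof.
apply/asboolP; split.
  by have [N aN] := cochain_bounded a; exists N => s /aN ->; rewrite mul0r.
move=> n; apply/discreteP => x.
have /discreteP/(_ x) ha := @cochain_continuous _ _ a n.
have /discreteP/(_ x) hb := @cochain_continuous _ _ b n.
by near=> y; congr (_ * _); near: y.
Unshelve. all: by end_near. Qed.
Definition cochain_pmul a b := Cochain (cochain_pmul_subproof a b).

Lemma cocycle1_anticomm a b : hcomp 1 a = a -> hcomp 1 b = b ->
  dgad a = 0 -> dgad b = 0 -> a * b + b * a = dgad (- cochain_pmul a b).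
Proof.
move=> a1 b1 a0 b0.
have p1 : hcomp 1 (- cochain_pmul a b) = - cochain_pmul a b.
  rewrite linearN; congr (- _); apply/cochain_hcompP => s s1 /=.
  by rewrite (cochain_deg a1) ?mul0r.
apply: cochain_ext => s.
have [/eqP|] := eqVneq (size s) 2; last first.
  move=> /eqP s2; rewrite -[LHS]/((a * b) s + (b * a) s).
  rewrite !(@cochain_deg _ 2 s) ?addr0 //.
  - exact: dgad_hcomp.
  - exact: (@hcomp_mul _ _ 1 1).
  - exact: (@hcomp_mul _ _ 1 1).
case: s => [|g [|h []]] // _.
rewrite -[LHS]/((a * b) [:: g; h] + (b * a) [:: g; h]) cochain_dgad1.
rewrite !cochain_mul11 //.
rewrite -[(- cochain_pmul a b) [:: h]]/(- (a [:: h] * b [:: h])).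
rewrite -[(- cochain_pmul a b) [:: g]]/(- (a [:: g] * b [:: g])).
rewrite -[(- cochain_pmul a b) [:: _]]/(- (a [:: (g * h)%g] * b [:: (g * h)%g])).
by rewrite !cocycle1M //; ring.
Qed.

(** A continuous function on [G] as a cochain of degree 1. *)
Fact cochain1_subproof (f : G -> K) : continuous (f : G -> discrete_topology K) ->
  ((fun s => if s is [:: g] then f g else 0) : seq G -> K^o) \in @cochain G K.
Proof.
move=> fc; apply/asboolP; split; first by exists 2 => -[|? []].
move=> [|[|n]]; apply/discreteP => x.
- by near=> y; rewrite !(size0nil (@size_lst _ _ _)).
- have sE (y : {ptws 'I_1 -> G}) :
      [seq y i | i : 'I_1] = [:: nth 1%g [seq y i | i : 'I_1] 0].
    by case: [seq _ | _ : _] (size_lst y) => [|? []].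
  have /discreteP := fun y => continuous_comp (@nth_lst_continuous G 1 0 y) (fc _).
  move=> /(_ x) fx; near=> y; rewrite (sE y) (sE x); near: y; exact: fx.
near=> y; case: [seq _ | _ : _] (size_lst y) => [|? []] //= ? ? _.
by case: [seq _ | _ : _] (size_lst x) => [|? []].
Unshelve. all: by end_near. Qed.

Definition cochain1 (f : G -> K) (fc : continuous (f : G -> discrete_topology K)) :=
  Cochain (cochain1_subproof fc).

Lemma cochain1_deg f fc : hcomp 1 (@cochain1 f fc) = cochain1 fc.
Proof. by apply/cochain_hcompP => -[|g []]. Qed.

Lemma cochain1_cocycle f fc :
  {morph f : g h / (g * h)%g >-> g + h} -> dgad (@cochain1 f fc) = 0.
Proof.
move=> fM; apply: cochain_ext => s.
have [/eqP|/eqP s2] := eqVneq (size s) 2; last first.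
  by apply: (@cochain_deg _ 2) => //; apply: dgad_hcomp; exact: cochain1_deg.
case: s => [|g [|h []]] // _; rewrite cochain_dgad1 /= fM.
by rewrite -[RHS]/(0 : K); ring.
Qed.

Lemma coh1_anticomm (x y : cohomology (cochains G K)) :
  hcomp 1 x = x -> hcomp 1 y = y -> x * y + y * x = 0.
Proof.
have rep u : hcomp 1 u = u ->
    exists a : cochains G K, [/\ hcomp 1 a = a, dgad a = 0 & coh_class a = u].
  move=> u1; have [a a0 aE] := coh_class_surj u.
  exists (hcomp 1 a); split; first by rewrite hcomp_hcomp.
    by rewrite -hcompS_dgad a0 linear0.
  by rewrite -coh_class_hcomp // aE.
move=> /rep[a [a1 a0 <-]] /rep[b [b1 b0 <-]].
rewrite -!coh_classM // -coh_classD ?dgadMl // cocycle1_anticomm //.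
by apply/coh_class_eq0; [exact: dgadK|eexists].
Qed.

End LowDegreeCochains.

(** * Characters of a group given by a presentation *)

(** The group Z/p, written multiplicatively, with the discrete topology. *)
Definition discrete_Fp (p : nat) := discrete_topology 'F_p.
HB.instance Definition _ p := DiscreteTopology.on (discrete_Fp p).
HB.instance Definition _ p := isGroup.Build (discrete_Fp p)
  (@addrA 'F_p) (@add0r 'F_p) (@addr0 'F_p) (@addNr 'F_p) (@addrN 'F_p).

Lemma discrete_continuous (X : discreteTopologicalType) (Y : topologicalType)
  (f : X -> Y) : continuous f.
Proof. by move=> x U /nbhs_singleton Ux; apply: filterS (discrete_set1 x) => _ ->. Qed.

Fact discrete_Fp_mul p :
  continuous (fun z : discrete_Fp p * discrete_Fp p => (z.1 * z.2)%g).
Proof.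
move=> [a b] U /nbhs_singleton /= Uab.
exists ([set a], [set b]); first by split; exact: discrete_set1.
by move=> [_ _] [/= -> ->].
Qed.
HB.instance Definition _ p := Topological_isTopGroup.Build (discrete_Fp p)
  (@discrete_Fp_mul p) (@discrete_continuous _ _ _).

Lemma pro_p_discrete_Fp (p : nat) : prime p -> pro_p_group p (discrete_Fp p).
Proof.
move=> p_pr; split.
- apply: finite_compact; exact: (@finite_finset 'F_p).
- exact: discrete_hausdorff.
- exact/zero_dimension_totally_disconnected/discrete_zero_dimension.
move=> N _ [N1 Nd _].
have Nmul (y : 'F_p) n : N y -> N (y *+ n).
  move=> Ny; elim: n => [//|n IH]; rewrite mulrS -[y *+ n]opprK.
  by apply: (Nd) => //; rewrite -[- _]add0r; exact: (Nd).
(* A subgroup with a non-zero element is everything, of index 1 = p ^ 0; the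
   trivial subgroup has index p. *)
have [[y [Ny y0]]|Ntriv] := pselect (exists y : 'F_p, N y /\ y != 0).
  exists 0%N; have NT : N = setT.
    apply/seteqP; split=> // z _.
    rewrite -[z](divfK y0) -[z / y]natr_Zp mulr_natl; exact: Nmul.
  have -> : [set [set (g * n)%g | n in N] | g in [set: discrete_Fp p]] = [set setT].
    apply/seteqP; split=> [_ [g _ <-]|_ ->].
      apply/seteqP; split=> // z _; exists (- g + z : 'F_p); first by rewrite NT.
      exact: addNKr.
    exists 0 => //; apply/seteqP; split=> // z _; exists z; rewrite ?NT //.
    exact: add0r.
  by rewrite expn0 card_set1.
exists 1%N; have NE : N = [set 0].
  apply/seteqP; split=> [y Ny|_ -> //]; apply/eqP; apply: contrapT => /negP y0.
  by apply: Ntriv; exists y.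
have -> : (fun g : discrete_Fp p => [set (g * n)%g | n in N]) = set1.
  by apply/funext => g; rewrite NE image_set1; congr [set _]; exact: addr0.
have -> : `I_(p ^ 1) = `I_(Zp_trunc (pdiv p)).+2 by rewrite expn1 Fp_cast.
rewrite card_eq_sym; apply: card_eq_trans card_II _; rewrite card_eq_sym.
apply: inj_card_eq => a b _ _ ab.
by have : [set b] a by rewrite -ab.
Qed.

Lemma hom1 (G H : groupType) (f : G -> H) :
  {morph f : a b / (a * b)%g} -> f 1%g = 1%g.
Proof. by move=> fM; apply: (@mulgI _ (f 1%g)); rewrite -fM !mulg1. Qed.

Lemma homV (G H : groupType) (f : G -> H) :
  {morph f : a b / (a * b)%g} -> {morph f : a / (a^-1)%g}.
Proof.
by move=> fM a; apply: (@mulgI _ (f a)); rewrite -fM !mulgV hom1.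
Qed.

(** For a pro-p group with generators [x i] and one relator [r], any assignment
    of elements of Z/p to the generators for which [r] becomes trivial extends
    to a continuous homomorphism. *)
Lemma hom_of_presentation (p d : nat) (F G : topGroupType) (x : 'I_d -> F)
    (pi : F -> G) (r : F) (y : 'I_d -> discrete_Fp p) : prime p ->
  free_pro_p p x ->
  topological_quotient (closed_normal_closure [set r]) pi ->
  (forall phi : F -> discrete_Fp p, {morph phi : a b / (a * b)%g} ->
    (forall i, phi (x i) = y i) -> phi r = 1%g) ->
  exists2 chi : G -> discrete_Fp p, continuous_hom chi
    & forall i, chi (pi (x i)) = y i.
Proof.
move=> p_pr [_ F_univ] [piM pi_onto pi_ker pi_open] r_triv.
have [phi [[[phiM phic] phix] _]] := F_univ _ y (pro_p_discrete_Fp p_pr).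
have r1 := r_triv _ phiM phix.
have phi1 := hom1 phiM; have phiV := homV phiM.
have phi_ker a : closed_normal_closure [set r] a -> phi a = 1%g.
  move=> /(_ (phi @^-1` [set 1%g])); apply; split.
  - split => /= [|a1 b a1E bE|a1 b a1E]; first exact: phi1.
      by rewrite phiM phiV a1E bE mulgV.
    by rewrite /conjg !phiM phiV a1E mul1g mulVg.
  - by apply: closed_comp => [a1 _|]; [exact: phic|exact: discrete_closed].
  - by move=> _ ->.
have piV := homV piM.
have phi_eq a b : pi a = pi b -> phi a = phi b.
  move=> ab; have : closed_normal_closure [set r] (a * b^-1)%g.
    by rewrite -pi_ker /= piM piV ab mulgV.
  by move=> /phi_ker; rewrite phiM phiV => /(canRL (mulgVK _)); rewrite mul1g.
have sec g : exists a, pi a = g.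
  by have [a _ <-] : range pi g; [rewrite pi_onto | exists a].
pose s g := projT1 (cid (sec g)).
have sK g : pi (s g) = g by rewrite /s; case: cid.
exists (phi \o s) => /= [|i]; last by rewrite -phix; apply: phi_eq; rewrite sK.
split=> [a b /=|].
  by rewrite -phiM; apply: phi_eq; rewrite piM !sK.
apply/continuousP => U oU; apply/pi_open.
rewrite (_ : _ @^-1` _ = phi @^-1` U); first by move/continuousP: phic; exact.
by apply/seteqP; split=> a /=; rewrite (phi_eq _ a) ?sK.
Qed.

Lemma discrete_Fp_expg (p : nat) (u : discrete_Fp p) n :
  (u ^+ n)%g = (u : 'F_p) *+ n.
Proof. by elim: n => [//|n IH]; rewrite expgS IH mulrS. Qed.

(** A homomorphism with commutative image only sees the cube in the relator. *)
Lemma relator_comm_morph (d : nat) (F H : groupType) (x : 'I_d -> F)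
    (f : F -> H) (i0 : 'I_d) : i0 = 0%N :> nat ->
  {morph f : a b / (a * b)%g} -> (forall a b, commute (f a) (f b)) ->
  f (relator x) = (f (x i0) ^+ 3)%g.
Proof.
move=> i00 fM fC.
have fR a b : f [~ a, b]%g = 1%g.
  by rewrite /commg /conjg !fM !homV //; apply/eqP/commgP/fC.
rewrite /relator fM (big_morph f fM (hom1 fM)) big1 => [|i _]; last exact: fR.
rewrite mulg1.
have -> : nth 1%g [seq x i | i : 'I_d] 0 = x i0.
  rewrite -[in LHS]i00 (nth_map i0) ?size_enum_ord //; congr x.
  by apply: val_inj; rewrite /= nth_enum_ord.
by rewrite !expgS expg0 !fM (hom1 fM).
Qed.

(** * The obstruction *)

(** The group of units [1 + a N + b N^2 + c N^3] of [R[N] / N^4]; the unit is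
    encoded as [(a, b, c)]. *)
Definition one_unit (R : comNzRingType) := (R * R * R)%type.

Section OneUnit.
Variable R : comNzRingType.
Implicit Types u v w : one_unit R.

Definition one_unit1 : one_unit R := (0, 0, 0).
Definition one_unit_mul u v : one_unit R :=
  let: (a, b, c) := u in let: (a', b', c') := v in
  (a + a', b + b' + a * a', c + c' + (a * b' + b * a')).
Definition one_unit_inv u : one_unit R :=
  let: (a, b, c) := u in (- a, a ^+ 2 - b, 2 * a * b - a ^+ 3 - c).

Fact one_unit_mulC : commutative one_unit_mul.
Proof. by move=> [[a b] c] [[a' b'] c']; congr (_, _, _); ring. Qed.
Fact one_unit_mulA : associative one_unit_mul.
Proof.
by move=> [[a b] c] [[a' b'] c'] [[a'' b''] c'']; congr (_, _, _); ring.
Qed.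
Fact one_unit_mul1 : left_id one_unit1 one_unit_mul.
Proof. by move=> [[a b] c]; congr (_, _, _); ring. Qed.
Fact one_unit_mulV : left_inverse one_unit1 one_unit_inv one_unit_mul.
Proof. by move=> [[a b] c]; congr (_, _, _); ring. Qed.
Fact one_unit_mulr1 : right_id one_unit1 one_unit_mul.
Proof. by move=> u; rewrite one_unit_mulC one_unit_mul1. Qed.
Fact one_unit_mulrV : right_inverse one_unit1 one_unit_inv one_unit_mul.
Proof. by move=> u; rewrite one_unit_mulC one_unit_mulV. Qed.

HB.instance Definition _ := Choice.on (one_unit R).
HB.instance Definition _ := isGroup.Build (one_unit R) one_unit_mulA
  one_unit_mul1 one_unit_mulr1 one_unit_mulV one_unit_mulrV.

Lemma one_unit_cube u : 3 \in [pchar R] -> (u ^+ 3)%g = (0, 0, u.1.1 ^+ 3).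
Proof.
move=> /andP[_ /eqP c3]; case: u => [[a b] c] /=; congr (_, _, _).
- rewrite -[RHS](mulr0 a) -c3; ring.
- rewrite -[RHS](mulr0 (a ^+ 2 + b)) -c3; ring.
- rewrite -[RHS]addr0 -[X in _ = _ + X](mulr0 (2 * a * b + c)) -c3; ring.
Qed.

End OneUnit.

(** A character [a] such that <a, a, a> contains 0 vanishes on the first
    generator of a group in which the relator is trivial: with the cochains [b]
    and [c] it makes up a homomorphism to [one_unit 'F_3], which sends the
    relator to the cube of the image of the first generator. *)
Lemma massey_obstruction (d : nat) (E : groupType) (G : topGroupType)
    (x : 'I_d -> E) (pi : E -> G) (i0 : 'I_d) (a b c : cochains G 'F_3) :
  i0 = 0%N :> nat -> {morph pi : g h / (g * h)%g} -> pi (relator x) = 1%g ->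
  [/\ hcomp 1 a = a, hcomp 1 b = b & hcomp 1 c = c] ->
  dgad a = 0 -> dgad b = - (a * a) -> dgad c = - (a * b + b * a) ->
  a [:: pi (x i0)] = 0.
Proof.
move=> i00 piM rel1 [a1 b1 c1] a0 bE cE.
pose f g : one_unit 'F_3 := (a [:: g], b [:: g], c [:: g]).
have fM : {morph f : g h / (g * h)%g}.
  move=> g h; congr (_, _, _); first exact: cocycle1M.
    have := cochain_dgad1 b g h; rewrite bE -[LHS]/(- (a * a) [:: g; h]).
    rewrite cochain_mul11 // => e.
    rewrite -[a [:: g] * _]opprK e; ring.
  have := cochain_dgad1 c g h.
  rewrite cE -[LHS]/(- ((a * b) [:: g; h] + (b * a) [:: g; h])).
  rewrite !cochain_mul11 // => e.
  rewrite -[a [:: g] * _ + _]opprK e; ring.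
have fpiM : {morph f \o pi : g h / (g * h)%g} by move=> g h /=; rewrite piM fM.
have := relator_comm_morph x i00 fpiM (fun _ _ => one_unit_mulC _ _).
rewrite /comp rel1 (hom1 fM) one_unit_cube // => /(congr1 snd).
rewrite -[LHS]/(0 : 'F_3) -[RHS]/(a [:: pi (x i0)] ^+ 3) => /esym/eqP.
by rewrite expf_eq0 => /andP[_ /eqP].
Qed.

(** The cocycle of degree 1 given by the character that is 1 on all
    generators. *)
Lemma exists_character (d : nat) (F G : topGroupType) (x : 'I_d -> F)
    (pi : F -> G) (i0 : 'I_d) : i0 = 0%N :> nat -> free_pro_p 3 x ->
  topological_quotient (closed_normal_closure [set relator x]) pi ->
  exists a : cochains G 'F_3,
    [/\ hcomp 1 a = a, dgad a = 0 & a [:: pi (x i0)] = 1].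
Proof.
move=> i00 F_free pi_quot.
have [//|chi [chiM chic] chix] := @hom_of_presentation 3 _ _ _ _ _ _
  (fun=> 1 : 'F_3) isT F_free pi_quot.
  move=> phi phiM phix.
  rewrite (relator_comm_morph x i00 phiM (fun _ _ => @addrC 'F_3 _ _)) phix.
  by rewrite discrete_Fp_expg; apply/eqP.
exists (cochain1 chic); split; first exact: cochain1_deg.
  exact: cochain1_cocycle.
exact: chix.
Qed.

Lemma F3_double_eq0 (V : lmodType 'F_3) (v : V) : v + v = 0 -> v = 0.
Proof.
move=> vv0; have e : 1 = (1 + 1) + (1 + 1) :> 'F_3 by apply/eqP.
by rewrite -[v]scale1r e !scalerDl scale1r vv0 addr0.
Qed.

Theorem theorem6p12 (d : nat) (d_ge2 : (2 <= d)%N) (d_even : ~~ odd d)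
    (F G : topGroupType) (x : 'I_d -> F) (pi : F -> G)
    (F_free : free_pro_p 3 x)
    (pi_quot : topological_quotient
                 (closed_normal_closure [set relator x]%classic) pi) :
  gamma G <> 0 /\ ~ A3_formal_group 3 G.
Proof.
pose i0 : 'I_d := Ordinal (ltnW d_ge2).
have i00 : i0 = 0%N :> nat by [].
have [piM _ pi_ker _] := pi_quot.
have rel1 : pi (relator x) = 1%g.
  suff : [set g | pi g = 1%g] (relator x) by [].
  by rewrite pi_ker => N [_ _]; exact.
have [a [a1 a0 ax]] := exists_character i00 F_free pi_quot.
have X1 : hcomp 1 (coh_class a) = coh_class a.
  exact: (@homog_coh_class _ _ (Posz 1) a a0 a1).
apply: (massey_obstructs_formality a1 a0).
- exact: F3_double_eq0 (coh1_anticomm X1 X1).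
- by move=> y; exact: coh1_anticomm.
move=> b c b1 c1 bE cE.
have := massey_obstruction i00 piM rel1 (And3 a1 b1 c1) a0 bE cE.
by rewrite ax => /eqP; rewrite oner_eq0.
Qed.
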